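(* Let $\mathcal{A}$ be a unital $C^*$-algebra. The sets $\mathcal{M}\Phi_+(H_{\mathcal{A}}) \setminus \mathcal{M}\Phi(H_{\mathcal{A}})$ and $\mathcal{M}\Phi_-(H_{\mathcal{A}}) \setminus \mathcal{M}\Phi(H_{\mathcal{A}})$ are open in $B^a(H_{\mathcal{A}})$, where $B^a(H_{\mathcal{A}})$ is equipped with the norm topology.
   Context: $\mathcal{A}$ is a unital $C^*$-algebra; $H_{\mathcal{A}} = \ell^2(\mathcal{A})$ is the standard Hilbert $\mathcal{A}$-module, and $B^a(H_{\mathcal{A}})$ is the $C^*$-algebra of bounded adjointable $\mathcal{A}$-linear operators on it. $M \tilde\oplus N$ denotes a direct sum of closed submodules that is not necessarily orthogonal. A Hilbert module is finitely generated if it is the (algebraic) $\mathcal{A}$-linear span of a finite set. An isomorphism of Hilbert modules is a bounded $\mathcal{A}$-linear bijection (with bounded inverse). For $F \in B^a(H_{\mathcal{A}})$ consider closed submodules with $H_{\mathcal{A}} = M_1 \tilde\oplus N_1 = M_2 \tilde\oplus N_2$, $F(M_1) \subseteq M_2$, $F(N_1) \subseteq N_2$ and $F|_{M_1}: M_1 \to M_2$ an isomorphism. $F \in \mathcal{M}\Phi_+(H_{\mathcal{A}})$ if such a decomposition exists with $N_1$ finitely generated; $F \in \mathcal{M}\Phi_-(H_{\mathcal{A}})$ if such a decomposition exists with $N_2$ finitely generated; $F \in \mathcal{M}\Phi(H_{\mathcal{A}})$ if a single such decomposition exists with both $N_1$ and $N_2$ finitely generated. *)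

(* Defs.v *)
From HB Require Import structures.
From mathcomp Require Import all_boot all_order all_algebra.
From mathcomp Require Import complex.
From mathcomp Require Import all_classical all_reals all_analysis.
Set Implicit Arguments.
Unset Strict Implicit.
Unset Printing Implicit Defensive.
Import Order.TTheory GRing.Theory Num.Theory.
Import numFieldNormedType.Exports.
Local Open Scope classical_set_scope.
Local Open Scope ring_scope.
Local Open Scope complex_scope.

(* Unital C*-algebras: Banach spaces over R[i] with a bilinear associative unital
   product and a conjugate-linear anti-multiplicative involution satisfying the
   C*-identity; the zero algebra is allowed. Hierarchy-Builder accepts no
   structure inheriting both from rings and from normed modules that is not
   below [numDomainType], so the product is a field of a record, from which a
   ring instance is derived on the carrier. *)
Record unitalCStarType (R : realType) := UnitalCStar {
  cstar_base : completeNormedModType R[i];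
  cstar_one : cstar_base;
  cstar_mul : cstar_base -> cstar_base -> cstar_base;
  cstar_star : cstar_base -> cstar_base;
  cstar_mulA : associative cstar_mul;
  cstar_mul1l : left_id cstar_one cstar_mul;
  cstar_mul1r : right_id cstar_one cstar_mul;
  cstar_mulDl : left_distributive cstar_mul +%R;
  cstar_mulDr : right_distributive cstar_mul +%R;
  cstar_scaleAl : forall (c : R[i]) a b,
    c *: cstar_mul a b = cstar_mul (c *: a) b;
  cstar_scaleAr : forall (c : R[i]) a b,
    c *: cstar_mul a b = cstar_mul a (c *: b);
  cstar_normM : forall a b, `|cstar_mul a b| <= `|a| * `|b|;
  cstar_starK : involutive cstar_star;
  cstar_starD : forall a b, cstar_star (a + b) = cstar_star a + cstar_star b;
  cstar_starZ : forall (c : R[i]) a, cstar_star (c *: a) = c^* *: cstar_star a;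
  cstar_starM : forall a b,
    cstar_star (cstar_mul a b) = cstar_mul (cstar_star b) (cstar_star a);
  cstar_identity : forall a, `|cstar_mul (cstar_star a) a| = `|a| ^+ 2 }.

Definition cstar_sort (R : realType) (A : unitalCStarType R) : Type :=
  cstar_base A.
Coercion cstar_sort : unitalCStarType >-> Sortclass.

HB.instance Definition _ (R : realType) (A : unitalCStarType R) :=
  CompleteNormedModule.copy (cstar_sort A) (cstar_base A).
HB.instance Definition _ (R : realType) (A : unitalCStarType R) :=
  GRing.Zmodule_isPzRing.Build (cstar_sort A) (@cstar_mulA R A)
    (@cstar_mul1l R A) (@cstar_mul1r R A) (@cstar_mulDl R A) (@cstar_mulDr R A).

Definition star (R : realType) (A : unitalCStarType R) (a : A) : A :=
  @cstar_star R A a.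

Section StandardModule.
Variables (R : realType) (A : unitalCStarType R).
Implicit Types (x y : nat -> A) (M N : set (nat -> A)).

(* A-valued inner product, conjugate-linear in the first argument; it is
   meaningful for x and y in [l2], where the series converges in norm. *)
Definition inner x y : A := lim (series (fun i => star (x i) * y i) @ \oo).

(* The standard Hilbert module, as a set of sequences. *)
Definition l2 : set (nat -> A) :=
  [set x | cvg (series (fun i => star (x i) * x i) @ \oo)].

(* The norm of A takes (real) values in R[i], hence the real part. *)
Definition l2norm x : R := Num.sqrt (complex.Re `|inner x x|).

Definition ract x (a : A) : nat -> A := fun i => x i * a.

(* Stability under complex scalars is included: c *: x = ract x (c *: 1). *)
Definition closed_submodule M : Prop :=
  [/\ M `<=` l2,
      M 0,
      forall x y, M x -> M y -> M (x + y),
      forall x a, M x -> M (ract x a)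
    & forall x, l2 x ->
        (forall e : R, 0 < e -> exists2 y, M y & l2norm (x - y) < e) -> M x].

(* Direct, not necessarily orthogonal, decomposition of the whole of [l2] *)
Definition direct_sum_decomp M N : Prop :=
  [/\ closed_submodule M, closed_submodule N,
      M `&` N = [set 0]
    & forall x, l2 x -> exists m n, [/\ M m, N n & x = m + n]].

Definition finitely_generated N : Prop :=
  exists (n : nat) (g : 'I_n -> nat -> A),
    N = [set x | exists a : 'I_n -> A, x = \sum_(i < n) ract (g i) (a i)].

Definition linear_on M (T : (nat -> A) -> nat -> A) : Prop :=
  (forall x y, M x -> M y -> T (x + y) = T x + T y) /\
  (forall x a, M x -> T (ract x a) = ract (T x) a).

Definition bounded_on M (T : (nat -> A) -> nat -> A) : Prop :=
  exists c : R, forall x, M x -> l2norm (T x) <= c * l2norm x.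

(* The restriction of T is a bounded A-linear bijection from M to N whose
   inverse is bounded (last clause). *)
Definition hilbert_iso M N (T : (nat -> A) -> nat -> A) : Prop :=
  [/\ linear_on M T, set_bij M N T, bounded_on M T
    & exists c : R, forall x, M x -> l2norm x <= c * l2norm (T x)].

(* B^a(H_A). Operators are functions on all sequences; [Ba_out] fixes their
   value outside [l2], so that an element of [Ba] is determined by its
   restriction to [l2]. *)
Record Ba := MkBa {
  Ba_fun :> (nat -> A) -> nat -> A;
  Ba_l2 : forall x, l2 x -> l2 (Ba_fun x);
  Ba_out : forall x, ~ l2 x -> Ba_fun x = 0;
  Ba_linear : linear_on l2 Ba_fun;
  Ba_bounded : bounded_on l2 Ba_fun;
  Ba_adjoint : exists G : (nat -> A) -> nat -> A,
    (forall y, l2 y -> l2 (G y)) /\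
    (forall x y, l2 x -> l2 y -> inner (Ba_fun x) y = inner x (G y)) }.

(* The operator norm of F - G *)
Definition opdist (F G : Ba) : R :=
  sup [set l2norm (F x - G x) | x in [set x | l2 x /\ l2norm x <= 1]].

Definition norm_open (S : set Ba) : Prop :=
  forall F, S F -> exists2 e : R, 0 < e & forall G, opdist F G < e -> S G.

Lemma norm_openT : norm_open setT.
Proof. by move=> F _; exists 1. Qed.

Lemma norm_openI : setI_closed norm_open.
Proof.
move=> S T oS oT F [SF TF].
have [e e0 eS] := oS F SF; have [d d0 dT] := oT F TF.
exists (Num.min e d); first by rewrite lt_min e0 d0.
by move=> G; rewrite lt_min => /andP[Ge Gd]; split; [exact: eS|exact: dT].
Qed.

Lemma norm_open_bigcup (I : Type) (f : I -> set Ba) :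
  (forall i, norm_open (f i)) -> norm_open (\bigcup_i f i).
Proof.
move=> of_ F [i _ fiF]; have [e e0 ef] := of_ i F fiF.
by exists e => // G /ef fG; exists i.
Qed.

HB.instance Definition _ := gen_eqMixin Ba.
HB.instance Definition _ := gen_choiceMixin Ba.
(* The norm topology on B^a(H_A) *)
HB.instance Definition _ :=
  isOpenTopological.Build Ba norm_openT norm_openI norm_open_bigcup.

Definition MPhi_decomp (F : Ba) M1 N1 M2 N2 : Prop :=
  [/\ direct_sum_decomp M1 N1, direct_sum_decomp M2 N2,
      F @` M1 `<=` M2, F @` N1 `<=` N2 & hilbert_iso M1 M2 F].

Definition MPhi_plus : set Ba := [set F | exists M1 N1 M2 N2,
  MPhi_decomp F M1 N1 M2 N2 /\ finitely_generated N1].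

Definition MPhi_minus : set Ba := [set F | exists M1 N1 M2 N2,
  MPhi_decomp F M1 N1 M2 N2 /\ finitely_generated N2].

Definition MPhi : set Ba := [set F | exists M1 N1 M2 N2,
  [/\ MPhi_decomp F M1 N1 M2 N2, finitely_generated N1
    & finitely_generated N2]].

End StandardModule.

Arguments MPhi_plus {R} A.
Arguments MPhi_minus {R} A.
Arguments MPhi {R} A.

(* Main.v *)
Require Import Defs.
From mathcomp Require Import all_boot all_order all_algebra.
From mathcomp Require Import complex.
From mathcomp Require Import all_classical all_reals all_analysis.
From mathcomp Require Import ring lra.

(** Write [F] in a decomposition [M1 + N1 -> M2 + N2] as the diagonal matrix of
    an isomorphism [M1 -> M2] and a map [N1 -> N2].  If [G] is close to [F], the
    corner [p G : M1 -> M2], where [p] projects onto [M2] along [N2], is still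
    invertible ([MPhi_decomp_near]).  This gives a decomposition for [G]
    with the four summands [M1], [G^-1 N2], [G M1] and [N2]
    ([corner_decomp]): the last one is the old [N2], and the second one is, like
    [N1], a complement of [M1].  As two complements of the same submodule are
    isomorphic ([fg_complement]), the old and the new decompositions have the
    same finiteness properties, and [G] is semi-Fredholm on the same side as [F].

    It remains to see that [G] is not Fredholm unless [F] is.  This is an
    algebraic fact about one operator with two decompositions, the first with
    both [N1] and [N2] finitely generated: in the second one, [N1'] is finitely
    generated if and only if [N2'] is.  Indeed both decompositions split an
    isomorphism off the complex [G : H -> H], so [N1 -> N2] and [N1' -> N2'] are
    homotopy equivalent and [N1 + N2'] is isomorphic to [N1' + N2].  The
    parts of this isomorphism that matter are written down in
    [fg_kernel_part] and [fg_cokernel_part].  Applied to [G], to a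
    Fredholm decomposition of [G] and to the one built from [F], this makes the
    decomposition of [F] itself Fredholm.

    The analysis behind the perturbation argument consists of two things.  The
    projection [p] is bounded, by the Baire category argument of the
    open mapping theorem ([direct_sum_bound]).  And [l2] is a complete
    normed space, which rests on the positivity of [x^* x] in
    a C*-algebra ([pos_starM]): it makes the norm of [\sum_i x_i^* x_i] monotone
    in the set of summands and yields the triangle inequality ([segD]).
    Positivity is treated through norms alone: [a] is bounded above by [t] if
    [|r + a| <= r + t] for some real [r >= 0], and spectral radii are replaced by
    the identity [|a^(2^k)| = |a|^(2^k)] for self-adjoint [a]. *)

Set Implicit Arguments.
Unset Strict Implicit.
Unset Printing Implicit Defensive.
Import Order.TTheory GRing.Theory Num.Theory.
Import numFieldNormedType.Exports.
Local Open Scope classical_set_scope.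
Local Open Scope ring_scope.
Local Open Scope complex_scope.

(** * The algebra with a real-valued norm *)
Section Norm.
Variables (R : realType) (A : unitalCStarType R).
Implicit Types (a b c h p q z : A) (r s t : R).

(** The norm of the algebra lies in [R[i]], whose order is partial; all estimates
    are carried out in [R] instead. *)
Definition rnorm a : R := complex.Re `|a|.

Lemma normE a : `|a| = (rnorm a)%:C.
Proof. by rewrite /rnorm RRe_real // normr_real. Qed.

Lemma rnorm_ge0 a : 0 <= rnorm a.
Proof. by have := normr_ge0 a; rewrite normE lecR. Qed.

Lemma rnorm0 : rnorm 0 = 0.
Proof. by rewrite /rnorm normr0. Qed.

Lemma rnorm_eq0 a : rnorm a = 0 -> a = 0.
Proof. by move=> a0; apply/eqP; rewrite -normr_eq0 normE a0. Qed.

Lemma rnormD a b : rnorm (a + b) <= rnorm a + rnorm b.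
Proof. by rewrite -lecR rmorphD /= -!normE ler_normD. Qed.

Lemma rnormN a : rnorm (- a) = rnorm a.
Proof. by rewrite /rnorm normrN. Qed.

Lemma rnormC a b : rnorm (a - b) = rnorm (b - a).
Proof. by rewrite -rnormN opprB. Qed.

Lemma rnormB a b : rnorm (a - b) <= rnorm a + rnorm b.
Proof. by rewrite -(rnormN b) rnormD. Qed.

Lemma rnormM a b : rnorm (a * b) <= rnorm a * rnorm b.
Proof. by rewrite -lecR rmorphM /= -!normE cstar_normM. Qed.

Lemma rnorm_starM a : rnorm (star a * a) = rnorm a ^+ 2.
Proof.
apply: complexI; rewrite rmorphXn /= -!normE; exact: cstar_identity.
Qed.

Lemma starK a : star (star a) = a.
Proof. exact: cstar_starK. Qed.

Lemma starD a b : star (a + b) = star a + star b.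
Proof. exact: cstar_starD. Qed.

Lemma starM a b : star (a * b) = star b * star a.
Proof. exact: cstar_starM. Qed.

Lemma starZ (k : R[i]) a : star (k *: a) = k^* *: star a.
Proof. exact: cstar_starZ. Qed.

Lemma star0 : star (0 : A) = 0.
Proof. by apply: (addrI (star 0)); rewrite -starD !addr0. Qed.

Lemma starN a : star (- a) = - star a.
Proof. by apply: (addrI (star a)); rewrite -starD !subrr star0. Qed.

Lemma star1 : star (1 : A) = 1.
Proof. by rewrite -[LHS]mul1r -{1}(starK 1) -starM mul1r starK. Qed.

Lemma starX a n : star (a ^+ n) = star a ^+ n.
Proof.
elim: n => [|n IH]; first by rewrite !expr0 star1.
by rewrite exprS starM IH exprSr.
Qed.

(** The C*-identity gives [|b|^2 <= |b^*| |b|], hence [|b| <= |b^*|], and the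
    involution exchanges the two sides. *)
Lemma rnorm_star a : rnorm (star a) = rnorm a.
Proof.
have le b : rnorm b <= rnorm (star b).
  have [->//|b0] := eqVneq (rnorm b) 0; first exact: rnorm_ge0.
  have b_gt0 : 0 < rnorm b by rewrite lt0r b0 rnorm_ge0.
  by rewrite -(ler_pM2r b_gt0) -expr2 -rnorm_starM rnormM.
by apply/eqP; rewrite eq_le le -{2}(starK a) le.
Qed.

Lemma rnorm_sqr a : star a = a -> rnorm (a * a) = rnorm a ^+ 2.
Proof. by move=> sa; rewrite -rnorm_starM sa. Qed.

Lemma rnorm1_le1 : rnorm (1 : A) <= 1.
Proof.
have := rnorm_sqr star1; rewrite mulr1 expr2 => e.
have [->//|n0] := eqVneq (rnorm (1 : A)) 0.
by rewrite -(mulfI n0 (x1 := 1) (x2 := rnorm 1)) // mulr1.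
Qed.

(** Iterated C*-identity: a self-adjoint element has its norm as spectral
    radius. *)
Lemma rnorm_expr2 a k : star a = a -> rnorm (a ^+ (2 ^ k)) = rnorm a ^+ (2 ^ k).
Proof.
move=> sa; elim: k => [|k IH]; first by rewrite !expr1.
by rewrite expnS mul2n -addnn !exprD rnorm_sqr ?IH // starX sa.
Qed.

(** Real scalars of the algebra, used instead of the scaling so that all
    computations take place in the ring. *)
Definition rs t : A := t%:C *: (1 : A).

Lemma rsE t a : rs t * a = t%:C *: a.
Proof. by rewrite -[RHS](congr1 _ (mul1r a)) [RHS](@cstar_scaleAl R A). Qed.

Lemma rsC t a : rs t * a = a * rs t.
Proof. by rewrite rsE -{1}[a]mulr1 [LHS](@cstar_scaleAr R A). Qed.

Lemma rsD s t : rs (s + t) = rs s + rs t.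
Proof. by rewrite /rs rmorphD /= scalerDl. Qed.

Lemma rsN t : rs (- t) = - rs t.
Proof. by rewrite /rs rmorphN /= scaleNr. Qed.

Lemma rsM s t : rs (s * t) = rs s * rs t.
Proof. by rewrite rsE /rs scalerA rmorphM. Qed.

Lemma rs1 : rs 1 = 1.
Proof. by rewrite /rs scale1r. Qed.

Lemma rs0 : rs 0 = 0.
Proof. by rewrite /rs scale0r. Qed.

Lemma star_rs t : star (rs t) = rs t.
Proof.
by rewrite /rs starZ star1; congr (_ *: _); exact: conjc_real.
Qed.

Lemma rnorm_rsM t a : rnorm (rs t * a) = `|t| * rnorm a.
Proof.
apply: complexI; rewrite rmorphM /= -!normE rsE normrZ normE; congr (_ * _).
by rewrite normc_def /= expr0n addr0 sqrtr_sqr.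
Qed.

Lemma rnorm_rs t : rnorm (rs t) <= `|t|.
Proof. by rewrite -[rs t]mulr1 rnorm_rsM ler_piMr ?rnorm1_le1. Qed.

Definition ii : A := 'i%C *: (1 : A).

Lemma iiE a : ii * a = 'i%C *: a.
Proof. by rewrite -[RHS](congr1 _ (mul1r a)) [RHS](@cstar_scaleAl R A). Qed.

Lemma iiC a : ii * a = a * ii.
Proof. by rewrite iiE -{1}[a]mulr1 [LHS](@cstar_scaleAr R A). Qed.

Lemma iiM : ii * ii = -1.
Proof. by rewrite iiE scalerA -expr2 sqr_i scaleN1r. Qed.

Lemma star_ii : star ii = - ii.
Proof.
rewrite /ii starZ star1 -scaleNr; congr (_ *: _).
by apply/eqP; rewrite eq_complex /= oppr0 !eqxx.
Qed.

End Norm.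

(** * Square roots *)
Lemma le_addgt0 (R : realType) (x y K : R) : 0 <= K ->
  (forall e, 0 < e -> x <= y + K * e) -> x <= y.
Proof.
move=> K0 h; apply/ler_addgt0Pr => e e0.
have K1 : 0 < K + 1 by rewrite ltr_wpDl.
apply: (le_trans (h (e / (K + 1)) _)); first by rewrite divr_gt0.
rewrite lerD2l mulrCA ler_piMr ?ltW // ltr_pdivrMr // mul1r.
by rewrite ltrDl.
Qed.

Section Sqrt.
Variables (R : realType) (A : unitalCStarType R).
Implicit Types (a b c h p z : A) (r s t : R) (y : nat -> A).

(** Convergence with real radii; it agrees with the topology by [tendstoP]. *)
Definition tendsto y a :=
  forall e : R, 0 < e -> exists N, forall n, (N <= n)%N -> rnorm (y n - a) < e.

Lemma tendstoP y a : tendsto y a <-> (y n @[n --> \oo] --> a).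
Proof.
split=> [ya|/cvgrPdist_lt ya e e0].
  apply/cvgrPdist_lt => e e0.
  have eE : e = (complex.Re e)%:C by rewrite RRe_real // gtr0_real.
  have := ya (complex.Re e); rewrite -ltcR -eE => /(_ e0) [N hN].
  by exists N => // n Nn; rewrite distrC normE eE ltcR hN.
have [|N _ hN] := ya e%:C; first by rewrite ltcR.
by exists N => n Nn; rewrite -ltcR -normE distrC hN.
Qed.

Lemma cauchy_tendsto y :
  (forall e : R, 0 < e -> exists N, forall n, (N <= n)%N -> rnorm (y n - y N) < e) ->
  exists a, tendsto y a.
Proof.
move=> hy.
suff cy : cvg (y @ \oo) by exists (lim (y @ \oo)); apply/tendstoP.
apply/cauchy_cvgP/cauchy_exP => e e0.
have eE : e = (complex.Re e)%:C by rewrite RRe_real // gtr0_real.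
have := hy (complex.Re e); rewrite -ltcR -eE => /(_ e0) [N hN].
exists (y N); exists N => // n Nn.
by rewrite /= -ball_normE /= distrC normE eE ltcR hN.
Qed.

Lemma tendsto_cauchy y a : tendsto y a ->
  forall e : R, 0 < e -> exists N, forall m n, (N <= m)%N -> (N <= n)%N ->
  rnorm (y n - y m) < e.
Proof.
move=> ya e e0; have [|N hN] := ya (e / 2); first by rewrite divr_gt0.
exists N => m n Nm Nn; rewrite -(subrKA a).
have := rnormD (y n - a) (a - y m); rewrite (rnormC a).
by have := hN _ Nm; have := hN _ Nn; lra.
Qed.

Lemma expr_small (q K e : R) : 0 <= q -> q < 1 -> 0 < e ->
  exists N, forall n, (N <= n)%N -> q ^+ n * K < e.
Proof.
move=> q0 q1 e0.
have K1 : 0 < `|K| + 1 by rewrite ltr_wpDl.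
have : q ^+ n @[n --> \oo] --> 0 by apply: cvg_expr; rewrite ger0_norm.
move=> /cvgrPdist_lt /(_ (e / (`|K| + 1))) [|N _ hN]; first by rewrite divr_gt0.
exists N => n /hN /=; rewrite sub0r normrN ger0_norm ?exprn_ge0 // ltr_pdivlMr //.
apply: le_lt_trans; rewrite ler_wpM2l ?exprn_ge0 //.
by rewrite (le_trans (ler_norm _)) // lerDl.
Qed.

Lemma geometric_tendsto y (q : R) : 0 <= q -> q < 1 ->
  (forall n, rnorm (y n.+1 - y n) <= q ^+ n) -> exists a, tendsto y a.
Proof.
move=> q0 q1 hq.
have hk k n : rnorm (y (n + k)%N - y n) <= q ^+ n * (1 - q)^-1.
  have q1' : 0 < 1 - q by rewrite subr_gt0.
  elim: k n => [n|k IH n].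
    by rewrite addn0 subrr rnorm0 mulr_ge0 ?exprn_ge0 // invr_ge0 ltW.
  rewrite -addSnnS -(subrKA (y n.+1)); apply: (le_trans (rnormD _ _)).
  apply: (le_trans (lerD (IH n.+1) (hq n))); rewrite exprS.
  have -> : q * q ^+ n / (1 - q) + q ^+ n = q ^+ n / (1 - q); last by [].
  by field; rewrite gt_eqF.
apply: cauchy_tendsto => e e0.
have [N hN] := expr_small (1 - q)^-1 q0 q1 e0.
exists N => n Nn; rewrite -(subnKC Nn).
exact: (le_lt_trans (hk _ _) (hN N (leqnn N))).
Qed.

(** Passing to the limit in an algebraic identity: the defect [b] of the limit is
    estimated by the distance to two successive approximations. *)
Lemma tendsto_eq0 y a b (K : R) : tendsto y a -> 0 <= K ->
  (forall n, rnorm b <= K * (rnorm (y n - a) + rnorm (y n.+1 - a))) -> b = 0.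
Proof.
move=> ya K0 hb; apply: rnorm_eq0; apply/eqP; rewrite eq_le rnorm_ge0 andbT.
apply: (@le_addgt0 _ _ _ (K * 2)) => [|e e0]; first by rewrite mulr_ge0.
have [N hN] := ya e e0; rewrite add0r -mulrA; apply: (le_trans (hb N)).
rewrite ler_wpM2l //; have := hN N (leqnn N); have := hN _ (leqnSn N); lra.
Qed.

(** The square root [1 - y] of [1 - h], by iterating the contraction
    [y |-> (h + y^2) / 2]. *)
Lemma sqrt_1B h : star h = h -> rnorm h < 1 ->
  exists c, [/\ star c = c, c * c = 1 - h
              & forall b, b * h = h * b -> b * c = c * b].
Proof.
move=> sh h1; pose th := rnorm h; pose q := (1 + th) / 2.
have th0 : 0 <= th by exact: rnorm_ge0.
(* As (1 - q)^2 <= 1 - th, the ball of radius q < 1 is stable by the iteration,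
   which contracts it with ratio q. *)
have q0 : 0 <= q by rewrite /q divr_ge0 // addr_ge0.
have q1 : q < 1 by rewrite /q; rewrite -/th in h1; lra.
pose y n : A := iter n (fun w : A => rs A 2^-1 * (h + w * w)) 0.
have yS n : y n.+1 = rs A 2^-1 * (h + y n * y n) by [].
have half x : rnorm (rs A 2^-1 * x) = 2^-1 * rnorm x.
  by rewrite rnorm_rsM ger0_norm // invr_ge0.
have yle n : rnorm (y n) <= q.
  elim: n => [|n IH]; first by rewrite rnorm0.
  rewrite yS half; have := rnormD h (y n * y n); have := rnormM (y n) (y n).
  have : rnorm (y n) * rnorm (y n) <= q * q by rewrite ler_pM ?rnorm_ge0.
  by rewrite -/th /q; rewrite -/th in h1; nra.
have subsqr a b : a * a - b * b = a * (a - b) + (a - b) * b.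
  by rewrite mulrBr mulrBl addrA subrK.
have dle n : rnorm (y n.+1 - y n) <= q ^+ n.
  elim: n => [|n IH].
    rewrite expr0 subr0 yS half mulr0 addr0 -/th; rewrite -/th in h1; lra.
  rewrite (yS n.+1) {2}yS -mulrBr half opprD addrACA subrr add0r subsqr.
  have := rnormD (y n.+1 * (y n.+1 - y n)) ((y n.+1 - y n) * y n).
  have := rnormM (y n.+1) (y n.+1 - y n); have := rnormM (y n.+1 - y n) (y n).
  have : rnorm (y n.+1) * rnorm (y n.+1 - y n) <= q * q ^+ n.
    by rewrite ler_pM ?rnorm_ge0.
  have : rnorm (y n.+1 - y n) * rnorm (y n) <= q ^+ n * q.
    by rewrite ler_pM ?rnorm_ge0.
  rewrite exprS; lra.
have [c yc] := geometric_tendsto q0 q1 dle.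
have sy n : star (y n) = y n.
  elim: n => [|n IH]; first by rewrite star0.
  by rewrite yS starM starD starM star_rs sh IH rsC.
have bP (n : nat) (K : R) : 0 <= K ->
    K * rnorm (y n - c) <= K * (rnorm (y n - c) + rnorm (y n.+1 - c)).
  by move=> K0; rewrite mulrDr lerDl mulr_ge0 ?rnorm_ge0.
have sc : star c = c.
  apply/eqP; rewrite -subr_eq0; apply/eqP; apply: (tendsto_eq0 (K := 2) yc) => // n.
  apply: (le_trans _ (bP n 2 _)) => //.
  rewrite -(subrKA (y n)) -{1}(sy n) -starN -starD.
  by apply: (le_trans (rnormD _ _)); rewrite rnorm_star rnormC; lra.
have cc : c + c = h + c * c.
  apply/eqP; rewrite -subr_eq0; apply/eqP.
  apply: (tendsto_eq0 (K := 2 + q + rnorm c) yc) => [|n].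
    by rewrite !addr_ge0 ?rnorm_ge0.
  have yy : y n.+1 + y n.+1 = h + y n * y n.
    by rewrite yS -mulrDl -rsD [_ + _](_ : _ = 1) ?rs1 ?mul1r //; lra.
  have -> : c + c - (h + c * c) =
      (y n * (y n - c) + (y n - c) * c) - ((y n.+1 - c) + (y n.+1 - c)).
    rewrite -subsqr addrACA yy -opprD opprB [RHS]addrC.
    by rewrite !opprD !addrA subrK.
  have := rnormB (y n * (y n - c) + (y n - c) * c) ((y n.+1 - c) + (y n.+1 - c)).
  have := rnormD (y n.+1 - c) (y n.+1 - c).
  have := rnormD (y n * (y n - c)) ((y n - c) * c).
  have := rnormM (y n) (y n - c); have := rnormM (y n - c) c.
  have : rnorm (y n) * rnorm (y n - c) <= q * rnorm (y n - c).
    by rewrite ler_pM ?rnorm_ge0.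
  have := rnorm_ge0 (y n - c); have := rnorm_ge0 (y n.+1 - c); have := rnorm_ge0 c.
  nra.
exists (1 - c); split => [||b bh].
- by rewrite starD starN star1 sc.
- have cB : c - c * c = h - c.
    by apply/eqP; rewrite subr_eq addrAC -cc addrK.
  by rewrite mulrBl mul1r mulrBr mulr1 cB opprB addrA subrK.
- suff bc : b * c = c * b by rewrite mulrBr mulrBl mulr1 mul1r bc.
  have by_ n : b * y n = y n * b.
    elim: n => [|n IH]; first by rewrite mulr0 mul0r.
    rewrite yS mulrA -rsC -!mulrA; congr (_ * _).
    by rewrite mulrDl mulrDr bh mulrA IH -mulrA IH mulrA.
  apply/eqP; rewrite -subr_eq0; apply/eqP.
  apply: (tendsto_eq0 (K := 2 * rnorm b) yc) => [|n].
    by rewrite mulr_ge0 ?rnorm_ge0.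
  apply: (le_trans _ (bP n _ _)); last by rewrite mulr_ge0 ?rnorm_ge0.
  have -> : b * c - c * b = (y n - c) * b - b * (y n - c).
    by rewrite mulrBl mulrBr by_ opprB [RHS]addrC subrKA.
  apply: (le_trans (rnormB _ _)).
  have := rnormM (y n - c) b; have := rnormM b (y n - c); lra.
Qed.

End Sqrt.

(** * Positivity *)

(** A factor growing linearly in the exponent disappears when roots of order
    [2^k] are taken; the contradiction comes from Bernoulli's inequality, applied
    to the square root of the power in order to beat the linear growth. *)
Lemma growth_le (R : realType) (x s K : R) : 0 <= x -> 0 < s -> 0 <= K ->
  (forall k, x ^+ (2 ^ k) <= (1 + (2 ^ k)%:R * K) * s ^+ (2 ^ k)) -> x <= s.
Proof.
move=> x0 s0 K0 hx; rewrite leNgt; apply/negP => sx.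
pose d := x / s - 1; have d0 : 0 < d by rewrite subr_gt0 ltr_pdivlMr // mul1r.
have hq k : (1 + d) ^+ (2 ^ k) <= 1 + (2 ^ k)%:R * K.
  by rewrite /d addrC subrK expr_div_n ler_pdivrMr // exprn_gt0.
have bern n : 1 + n%:R * d <= (1 + d) ^+ n.
  elim: n => [|n IH]; first by rewrite expr0 mul0r addr0.
  rewrite exprS -natr1; have := ler0n R n; move: IH d0; set X := _ ^+ n; nra.
pose k := Num.bound ((1 + 2 * K) / d ^+ 2).
have d20 : 0 < d ^+ 2 by rewrite exprn_gt0.
have hk : (1 + 2 * K) < (2 ^ k)%:R * d ^+ 2.
  rewrite -ltr_pdivrMr //; apply: (lt_le_trans (archi_boundP _)).
    by apply: divr_ge0; [rewrite addr_ge0 // mulr_ge0|exact: ltW].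
  by rewrite ler_nat ltnW // ltn_expl.
have M1 : 1 <= (2 ^ k)%:R :> R by rewrite ler1n expn_gt0.
have := hq k.+1; rewrite expnSr exprM natrM.
have := bern (2 ^ k)%N; move: hk M1.
set M := (2 ^ k)%:R; set X := (1 + d) ^+ _ => hk M1 hX.
have : (M * d) ^+ 2 <= X ^+ 2.
  rewrite ler_sqr ?nnegrE; [lra| |]; last by rewrite /X exprn_ge0 // addr_ge0 ?ltW.
  by rewrite mulr_ge0 ?ltW // (lt_le_trans _ M1).
have : M * (1 + 2 * K) < M * (M * d ^+ 2) by rewrite ltr_pM2l // (lt_le_trans _ M1).
rewrite exprMn; nra.
Qed.

Section Positive.
Variables (R : realType) (A : unitalCStarType R).
Implicit Types (a b c d h p z : A) (r s t e : R).
Local Notation rs := (rs A).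

(** For self-adjoint [a], this says that the spectrum of [a] lies below [t]. *)
Definition upper a t := exists2 r, 0 <= r & rnorm (rs r + a) <= r + t.
Definition pos p := upper (- p) 0.

Lemma rsCA t a b : a * (rs t * b) = rs t * (a * b).
Proof. by rewrite mulrA -rsC mulrA. Qed.

(** The condition passes to larger [r], which can therefore be assumed to be at
    least 1 when bounds on powers are compared. *)
Lemma upper_large a t : upper a t ->
  exists2 r, 0 <= r & forall s, r <= s -> rnorm (rs s + a) <= s + t.
Proof.
move=> [r r0 hr]; exists r => // s rs_.
rewrite -(subrK r s) rsD -addrA; apply: (le_trans (rnormD _ _)).
by rewrite -addrA lerD // (le_trans (rnorm_rs _ _)) // ger0_norm // subr_ge0.
Qed.

Lemma upperD a b s t : upper a s -> upper b t -> upper (a + b) (s + t).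
Proof.
move=> [r r0 hr] [r' r0' hr']; exists (r + r'); first by rewrite addr_ge0.
rewrite rsD addrACA [leRHS]addrACA.
by apply: (le_trans (rnormD _ _)); rewrite lerD.
Qed.

Lemma upper_rs t : upper (rs t) t.
Proof.
exists `|t| => //; rewrite -rsD; apply: (le_trans (rnorm_rs _ _)).
by rewrite (@ger0_norm _ (`|t| + t)) // -lerBlDr sub0r -normrN ler_norm.
Qed.

Lemma upper_rnorm a : upper a (rnorm a).
Proof. by exists 0; rewrite // rs0 !add0r. Qed.

Lemma posD p q : pos p -> pos q -> pos (p + q).
Proof. by move=> pp pq; rewrite /pos opprD -[0]addr0; exact: upperD. Qed.

Lemma pos0 : pos 0.
Proof. by exists 0; rewrite // subr0 rs0 rnorm0 addr0. Qed.

Lemma posZ t p : 0 <= t -> pos p -> pos (rs t * p).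
Proof.
move=> t0 [r r0 hr]; exists (t * r); first exact: mulr_ge0.
rewrite rsM -mulrN -mulrDr rnorm_rsM ger0_norm // addr0 ler_wpM2l //.
by move: hr; rewrite addr0.
Qed.

Lemma upperP a t : upper a t <-> pos (rs t - a).
Proof.
rewrite /pos opprB; split=> ha.
  by rewrite -(subrr t) -rsN; apply: upperD => //; exact: upper_rs.
by have := upperD ha (upper_rs t); rewrite subrK add0r.
Qed.

(** If [|r - p| <= r] then [p + e] is [(r + e) (1 - h)] with [|h| < 1].  The
    commutation clause makes all the roots taken below commute. *)
Lemma pos_sqrt p e : star p = p -> pos p -> 0 < e ->
  exists c, [/\ star c = c, c * c = p + rs e
              & forall b, b * p = p * b -> b * c = c * b].
Proof.
move=> sp [r r0 hr] e0; have re0 : 0 < r + e by rewrite ltr_wpDl.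
pose h := rs (r + e)^-1 * (rs r - p).
have sh : star h = h.
  by rewrite /h starM starD starN sp !star_rs rsC.
have h1 : rnorm h < 1.
  rewrite rnorm_rsM ger0_norm ?invr_ge0 ?ltW // mulrC ltr_pdivrMr // mul1r.
  by apply: (le_lt_trans hr); rewrite addr0 ltrDl.
have [c [sc cc cb]] := sqrt_1B sh h1.
exists (rs (Num.sqrt (r + e)) * c); split=> [||b bp].
- by rewrite starM star_rs sc rsC.
- have -> : p + rs e = rs (r + e) * (1 - h).
    rewrite mulrBr mulr1 mulrA -rsM mulfV ?gt_eqF // rs1 mul1r.
    by rewrite opprB rsD [RHS]addrC addrA subrK.
  by rewrite -cc -mulrA rsCA mulrA -rsM -expr2 sqr_sqrtr // ltW.
- rewrite rsCA -mulrA cb // /h rsCA -mulrA; congr (_ * _).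
  by rewrite mulrBl mulrBr bp rsC.
Qed.

(** Two commuting self-adjoint [c], [d] are the parts of the normal element
    [c + i d], whose squared modulus is [c^2 + d^2]. *)
Lemma rnorm_sqrD c d : star c = c -> star d = d -> c * d = d * c ->
  rnorm c ^+ 2 <= rnorm (c * c + d * d).
Proof.
move=> sc sd cd; pose u := c + ii A * d.
have su : star u = c - ii A * d.
  by rewrite starD starM star_ii sc sd mulrN -iiC.
have -> : c * c + d * d = star u * u.
  rewrite su mulrBl !mulrDr.
  have -> : ii A * d * (ii A * d) = - (d * d).
    by rewrite -mulrA (mulrA d) -(iiC d) -mulrA mulrA iiM mulN1r.
  have -> : c * (ii A * d) = ii A * d * c by rewrite mulrA -iiC -mulrA cd mulrA.
  by rewrite addrKA opprK.
rewrite rnorm_starM ler_sqr ?nnegrE ?rnorm_ge0 //.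
have -> : c = rs 2^-1 * (u + star u).
  rewrite su /u addrACA subrr addr0 mulrDr -mulrDl -rsD.
  by rewrite [_ + _](_ : _ = 1) ?rs1 ?mul1r //; lra.
rewrite rnorm_rsM ger0_norm ?invr_ge0 //.
by have := rnormD u (star u); rewrite rnorm_star; lra.
Qed.

(** With [r = |h|^2 + 1], the complement [r - h^2] is a square [c^2]; since
    [c^2 + h^2 = r], the norm of [c^2 = r - h^2] is at most [r]. *)
Lemma pos_sqr h : star h = h -> pos (h * h).
Proof.
move=> sh; pose r := rnorm h ^+ 2; have r0 : 0 <= r by rewrite exprn_ge0 ?rnorm_ge0.
have [|||c [sc cc cb]] := @pos_sqrt (rs r - h * h) 1 => //.
- by rewrite starD starN starM sh star_rs.
- by apply: (upperP _ _).1; rewrite /r -rnorm_sqr //; exact: upper_rnorm.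
have ch : c * h = h * c.
  by apply/esym/cb; rewrite mulrBl mulrBr rsC mulrA.
exists (r + 1); first by rewrite addr_ge0.
have e : rs (r + 1) - h * h = c * c by rewrite cc rsD addrAC.
rewrite e rnorm_sqr // addr0; apply: (le_trans (rnorm_sqrD sc sh ch)).
rewrite -e subrK; apply: (le_trans (rnorm_rs _ _)).
by rewrite ger0_norm // addr_ge0.
Qed.

(** Up to a small error, [p] and [t - p] are squares of commuting self-adjoint
    elements; as these squares add up to [t], each has norm at most [t]. *)
Lemma rnorm_le p t : star p = p -> 0 <= t -> pos p -> upper p t -> rnorm p <= t.
Proof.
move=> sp t0 pp /upperP pt; apply: (@le_addgt0 _ _ _ 3) => // e e0.
have [d [sd dd db]] := pos_sqrt sp pp e0.
have [|c [sc cc cb]] := pos_sqrt _ pt e0.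
  by rewrite starD starN sp star_rs.
have pd : p * d = d * p by apply: db.
have dc : d * c = c * d by apply: cb; rewrite mulrBl mulrBr pd rsC.
have := rnorm_sqrD sd sc dc; rewrite -rnorm_sqr // dd cc.
rewrite addrACA (addrC p (_ - p)) subrK -!rsD => hd.
have := rnorm_rs A (t + (e + e)); rewrite ger0_norm; last by rewrite !addr_ge0 // ltW.
have := rnormB (p + rs e) (rs e); rewrite addrK.
have := rnorm_rs A e; rewrite (ger0_norm (ltW e0)); lra.
Qed.

(** [z z^*] and [z^* z] have the same spectrum up to 0.  For upper bounds this
    follows from [X z = z Y], for [X = r + z z^*] and [Y = r + z^* z]: the norm
    of [X^n] exceeds [(r + t)^n] at most by a factor linear in [n]. *)
Lemma upper_starC z t : 0 <= t -> upper (star z * z) t -> upper (z * star z) t.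
Proof.
move=> t0 /upper_large[r r0 hr].
have [s s1 {}hr] : exists2 s, 1 <= s & rnorm (rs s + star z * z) <= s + t.
  by exists (r + 1); [rewrite lerDr|apply: hr; rewrite lerDl].
have s0 : 0 <= s by rewrite (le_trans _ s1).
exists s => //; move: hr.
set X := rs s + z * star z; set Y := rs s + star z * z => hY.
have Xz : X * z = z * Y by rewrite mulrDl mulrDr rsC mulrA.
have XzX n : X ^+ n * z = z * Y ^+ n.
  elim: n => [|n IH]; first by rewrite !expr0 mul1r mulr1.
  by rewrite !exprS -mulrA IH mulrA Xz mulrA.
have sX : star X = X by rewrite starD starM starK star_rs.
have st0 : 0 < s + t by rewrite ltr_pwDl // (lt_le_trans _ s1).
have nY n : rnorm (Y ^+ n) <= (s + t) ^+ n.
  elim: n => [|n IH]; first by rewrite !expr0 rnorm1_le1.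
  by rewrite !exprS (le_trans (rnormM _ _)) // ler_pM ?rnorm_ge0.
apply: (@growth_le _ _ _ (rnorm z ^+ 2)); rewrite ?rnorm_ge0 ?exprn_ge0 ?rnorm_ge0 // => k.
rewrite -rnorm_expr2 //.
elim: (2 ^ k)%N => [|n IH]; first by rewrite !expr0 mul0r addr0 mulr1 rnorm1_le1.
rewrite exprSr {2}/X mulrDr -rsC mulrA XzX.
apply: (le_trans (rnormD _ _)); rewrite rnorm_rsM ger0_norm //.
have h1 : rnorm (z * Y ^+ n * star z) <= rnorm z ^+ 2 * (s + t) ^+ n.
  apply: (le_trans (rnormM _ _)); rewrite rnorm_star expr2 mulrAC.
  rewrite ler_wpM2r ?rnorm_ge0 //; apply: (le_trans (rnormM _ _)).
  by rewrite ler_wpM2l ?rnorm_ge0.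
apply: (le_trans (lerD (ler_wpM2l _ IH) h1)) => //.
have z2 : 0 <= rnorm z ^+ 2 by rewrite exprn_ge0 ?rnorm_ge0.
rewrite (exprS (s + t)) -natr1.
have S0 : 0 <= (s + t) ^+ n by rewrite exprn_ge0 ?ltW.
have n0 : 0 <= n%:R :> R by [].
have n1 : 0 <= (1 + n%:R * rnorm z ^+ 2) * (s + t) ^+ n.
  by rewrite mulr_ge0 // addr_ge0 // mulr_ge0.
have : (t + s - 1) * (rnorm z ^+ 2 * (s + t) ^+ n) >= 0.
  by apply: mulr_ge0; [move: s1 t0; clear; lra|exact: mulr_ge0].
have : t * ((1 + n%:R * rnorm z ^+ 2) * (s + t) ^+ n) >= 0 by apply: mulr_ge0.
clear; set S := (s + t) ^+ n; set K := rnorm z ^+ 2; lra.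
Qed.

(** For [b = a^*], this writes [2 (a a^* + a^* a)] as the sum of the squares of
    the self-adjoint elements [a + a^*] and [i a - i a^*]. *)
Lemma polarization a b : (a + b) * (a + b) - (a - b) * (a - b) =
  (a * b + b * a) + (a * b + b * a).
Proof.
have -> : (a + b) * (a + b) - (a - b) * (a - b) =
    (a + b) * (b + b) + (b + b) * (a - b).
  have -> : b + b = (a + b) - (a - b) by rewrite opprB [RHS]addrC addrA subrK.
  move: (a + b) (a - b) => p q.
  by rewrite mulrBr mulrBl addrA subrK.
rewrite mulrDr (mulrDl b b) addrACA.
have -> // : (a + b) * b + b * (a - b) = a * b + b * a.
by rewrite mulrDl mulrBr addrACA subrr addr0.
Qed.

(** The point is that [x^* x] cannot have a negative part.  As [a = x^* x] is
    less than 1 in norm, [1 - a] is a square [c^2], and [1 - a <= 1] has to be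
    proved, that is, that the powers of [u = c^2] do not grow.  For [z = x c^n],
    [z^* z = u^n - u^(n+1)] is at most 1, since [1 - u^n + u^(n+1)] is a sum of
    squares; hence [z z^* <= 1], and as [z z^* + z^* z >= 0] this gives
    [z^* z >= -1].  So the difference of two successive powers of [u] is
    bounded, and [|u^n|] grows at most linearly. *)
Lemma pos_starM_small x : rnorm (star x * x) < 1 -> pos (star x * x).
Proof.
set a := star x * x => a1.
have sa : star a = a by rewrite starM starK.
have [c [sc cc cb]] := sqrt_1B sa a1.
have aE : a = 1 - c * c by rewrite cc opprB addrC subrK.
have sX n : star (c ^+ n) = c ^+ n by rewrite starX sc.
pose u := c * c.
have su : star u = u by rewrite starM sc.
have uX n : u ^+ n = c ^+ n * c ^+ n.
  by rewrite -exprD addnn -mul2n exprM expr2.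
have sqrB n : u ^+ n - u ^+ n.+1 - (u ^+ n.+1 - u ^+ n.+2) =
    (c ^+ n * (1 - u)) * (c ^+ n * (1 - u)).
  have cu : (1 - u) * c ^+ n = c ^+ n * (1 - u).
    by rewrite mulrBr mulrBl mulr1 mul1r /u -expr2 -!exprD addnC.
  rewrite mulrA -[X in _ = X * _]mulrA cu mulrA -uX.
  by rewrite !mulrBr !mulr1 -!exprSr mulrBl -!exprSr.
have su1 n : star (c ^+ n * (1 - u)) = c ^+ n * (1 - u).
  rewrite starM sX starD starN star1 su.
  by rewrite mulrBr mulrBl mulr1 mul1r /u -expr2 -!exprD addnC.
have up n : upper (u ^+ n - u ^+ n.+1) 1.
  apply/upperP; rewrite rs1; elim: n => [|n IH].
    by rewrite expr0 expr1 opprB addrC subrK; exact: pos_sqr.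
  have := posD IH (pos_sqr (su1 n)); rewrite -sqrB addrA subrK.
  by [].
have bnd n : rnorm (u ^+ n - u ^+ n.+1) <= 3.
  pose z := x * c ^+ n.
  have zz : star z * z = u ^+ n - u ^+ n.+1.
    rewrite starM sX mulrA -(mulrA _ (star x)) -/a aE mulrBr mulr1 mulrBl.
    by rewrite -uX; congr (_ - _); rewrite uX {1}exprSr exprS !mulrA.
  have szz : star (star z * z) = star z * z by rewrite starM starK.
  have zu := up n; rewrite -zz in zu *.
  have zu' := upper_starC ler01 zu.
  have sq : pos (z * star z + star z * z).
    have h1 : star (z + star z) = z + star z by rewrite starD starK addrC.
    have h2 : star (ii A * (z - star z)) = ii A * (z - star z).
      by rewrite starM star_ii starD starN starK mulrN -iiC -mulrN opprB.
    have := posZ (t := 2^-1) _ (posD (pos_sqr h1) (pos_sqr h2)).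
    rewrite invr_ge0 => /(_ (ler0n _ 2)); congr (pos _).
    have -> : ii A * (z - star z) * (ii A * (z - star z)) =
        - ((z - star z) * (z - star z)).
      by rewrite -mulrA (mulrA (z - _)) -(iiC (z - _)) -mulrA mulrA iiM mulN1r.
    rewrite polarization mulrDr -mulrDl -rsD.
    by rewrite [_ + _](_ : _ = 1) ?rs1 ?mul1r //; lra.
  have p1 : pos (1 + star z * z).
    have := posD ((upperP _ _).1 zu') sq; rewrite rs1 addrA subrK.
    by [].
  have s1 : star (1 + star z * z) = 1 + star z * z by rewrite starD star1 szz.
  have u2 : upper (1 + star z * z) 2.
    by have := upperD (upper_rs 1) zu; rewrite rs1.
  have := rnorm_le s1 (ler0n _ 2) p1 u2.
  have := rnormB (1 + star z * z) 1; rewrite [1 + _]addrC addrK.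
  have := rnorm1_le1 A; lra.
have un n : rnorm (u ^+ n) <= 1 + n%:R * 3.
  elim: n => [|n IH]; first by rewrite mul0r addr0 rnorm1_le1.
  have := rnormB (u ^+ n) (u ^+ n - u ^+ n.+1); have := bnd n.
  by rewrite subKr -natr1; lra.
exists 1 => //; rewrite rs1 addr0 -cc -/u.
apply: (@growth_le _ _ _ 3); rewrite ?rnorm_ge0 // => k.
by rewrite -rnorm_expr2 // expr1n mulr1.
Qed.

Lemma pos_starM x : pos (star x * x).
Proof.
pose t := Num.sqrt (rnorm (star x * x) + 1).
have n0 := rnorm_ge0 (star x * x).
have t0 : 0 < t by rewrite sqrtr_gt0 ltr_wpDl.
have tt : t * t = rnorm (star x * x) + 1 by rewrite -expr2 sqr_sqrtr // addr_ge0.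
have xE : star (rs t^-1 * x) * (rs t^-1 * x) = rs (t * t)^-1 * (star x * x).
  by rewrite starM star_rs -rsC -mulrA rsCA mulrA -rsM invfM.
have : pos (star (rs t^-1 * x) * (rs t^-1 * x)).
  apply: pos_starM_small; rewrite xE rnorm_rsM tt ger0_norm; last first.
    by rewrite invr_ge0 addr_ge0.
  by rewrite mulrC ltr_pdivrMr ?ltr_wpDl // mul1r ltrDl.
move=> /(posZ (t := t * t)); rewrite xE mulrA -rsM mulfV; last first.
  by rewrite mulf_neq0 ?gt_eqF.
by rewrite rs1 mul1r; apply; rewrite mulr_ge0 ?ltW.
Qed.

End Positive.

(** * The normed space l2 *)
Section L2.
Variables (R : realType) (A : unitalCStarType R).
Implicit Types (a b c p q : A) (r s t e : R) (x y z : nat -> A) (m n k : nat).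
Local Notation rs := (rs A).

Definition gram x m n : A := \sum_(m <= i < n) star (x i) * x i.

(** The norm of the part of [x] with indices from [m] to [n - 1].  All statements
    on [l2] are reduced to finite segments, by [l2P], [seg_l2norm] and
    [l2norm_le]. *)
Definition seg x m n : R := Num.sqrt (rnorm (gram x m n)).

Lemma star_gram x m n : star (gram x m n) = gram x m n.
Proof.
rewrite /gram; elim/big_ind: _ => [|a b sa sb|i _]; first exact: star0.
  by rewrite starD sa sb.
by rewrite starM starK.
Qed.

Lemma pos_gram x m n : pos (gram x m n).
Proof.
rewrite /gram; elim/big_ind: _ => [|a b sa sb|i _]; first exact: pos0.
  exact: posD.
exact: pos_starM.
Qed.

Lemma rnorm_pos_le p q : star p = p -> pos p -> pos q -> rnorm p <= rnorm (p + q).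
Proof.
move=> sp pp pq; apply: rnorm_le => //; first exact: rnorm_ge0.
by have := upperD (upper_rnorm (p + q)) pq; rewrite addrK addr0.
Qed.

Lemma seg_ge0 x m n : 0 <= seg x m n.
Proof. exact: sqrtr_ge0. Qed.

Lemma sqr_seg x m n : seg x m n ^+ 2 = rnorm (gram x m n).
Proof. by rewrite sqr_sqrtr ?rnorm_ge0. Qed.

Lemma seg_le x m n r : 0 <= r -> (seg x m n <= r) = (rnorm (gram x m n) <= r ^+ 2).
Proof. by move=> r0; rewrite -sqr_seg ler_sqr ?nnegrE ?seg_ge0. Qed.

Lemma seg_nil x m n : (n <= m)%N -> seg x m n = 0.
Proof. by move=> nm; rewrite /seg /gram big_geq // rnorm0 sqrtr0. Qed.

Lemma seg_sub x m n m' n' : (m' <= m)%N -> (n <= n')%N ->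
  seg x m n <= seg x m' n'.
Proof.
move=> mm nn; have [nm|mn] := leqP n m; first by rewrite seg_nil ?seg_ge0.
rewrite seg_le ?seg_ge0 // sqr_seg.
have -> : gram x m' n' = gram x m n + (gram x m' m + gram x n n').
  rewrite addrCA /gram -big_cat_nat ?(ltnW mn) //.
  by rewrite -big_cat_nat ?(leq_trans (ltnW mn)).
apply: rnorm_pos_le; [exact: star_gram|exact: pos_gram|].
by apply: posD; exact: pos_gram.
Qed.

Lemma star_rsM t s a b :
  star (rs t * a) * (rs s * b) = rs (t * s) * (star a * b).
Proof. by rewrite starM star_rs -rsC -mulrA rsCA mulrA -rsM. Qed.

(** The cross terms of [(a + b)^* (a + b)] are cancelled by a second positive
    term, which leads to the triangle inequality below by mere monotonicity of
    the norm. *)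
Lemma parallelogram t s a b : t * s = 1 ->
  star (a + b) * (a + b) + star (rs t * a - rs s * b) * (rs t * a - rs s * b)
  = rs (1 + t ^+ 2) * (star a * a) + rs (1 + s ^+ 2) * (star b * b).
Proof.
move=> ts; rewrite !starD starN !mulrDl !mulrDr !mulrN !mulNr !opprK !star_rsM.
rewrite (mulrC s t) ts rs1 !mul1r !rsD rs1 !mulrDl !mul1r -!expr2.
by rewrite addrACA (addrACA (star a * a)) subrr addr0 (addrACA (star b * a)) subrr add0r.
Qed.

Lemma gramD t s x y m n : t * s = 1 ->
  gram (x + y) m n + gram (fun i => rs t * x i - rs s * y i) m n
  = rs (1 + t ^+ 2) * gram x m n + rs (1 + s ^+ 2) * gram y m n.
Proof.
move=> ts; rewrite /gram !mulr_sumr -!big_split; apply: eq_bigr => i _ /=.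
exact: parallelogram.
Qed.

(** The weight [t^2 = |y| / |x|] minimizes
    [(1 + t^2) |x|^2 + (1 + t^-2) |y|^2], with minimum [(|x| + |y|)^2]; the norms
    are made positive by a small [e]. *)
Lemma segD x y m n : seg (x + y) m n <= seg x m n + seg y m n.
Proof.
apply: (@le_addgt0 _ _ _ 2) => // e e0.
set X := seg x m n; set Y := seg y m n.
have X0 : 0 <= X := seg_ge0 _ _ _; have Y0 : 0 <= Y := seg_ge0 _ _ _.
have aX : 0 < X + e by rewrite ltr_wpDl.
have bY : 0 < Y + e by rewrite ltr_wpDl.
pose q := (Y + e) / (X + e); have q0 : 0 < q by rewrite divr_gt0.
have ts : Num.sqrt q * (Num.sqrt q)^-1 = 1 by rewrite mulfV // gt_eqF // sqrtr_gt0.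
have := gramD x y m n ts; rewrite exprVn (sqr_sqrtr (ltW q0)) => gE.
rewrite seg_le; last by rewrite !addr_ge0 // mulr_ge0 // ltW.
apply: (le_trans (rnorm_pos_le (star_gram _ _ _) (pos_gram _ _ _)
  (pos_gram (fun i => rs (Num.sqrt q) * x i - rs (Num.sqrt q)^-1 * y i) m n))).
rewrite gE; apply: (le_trans (rnormD _ _)); rewrite !rnorm_rsM.
have q1 : 0 <= 1 + q by rewrite addr_ge0 ?ltW.
have q2 : 0 <= 1 + q^-1 by rewrite addr_ge0 // invr_ge0 ltW.
rewrite !ger0_norm // -!sqr_seg -/X -/Y.
have h1 : (1 + q) * X ^+ 2 <= (1 + q) * (X + e) ^+ 2.
  by rewrite ler_wpM2l // ler_sqr ?nnegrE ?lerDl ?(ltW e0) ?(ltW aX).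
have h2 : (1 + q^-1) * Y ^+ 2 <= (1 + q^-1) * (Y + e) ^+ 2.
  by rewrite ler_wpM2l // ler_sqr ?nnegrE ?lerDl ?(ltW e0) ?(ltW bY).
apply: (le_trans (lerD h1 h2)); rewrite le_eqVlt; apply/orP; left; apply/eqP.
by rewrite /q; field; rewrite !gt_eqF.
Qed.

Lemma segN x m n : seg (- x) m n = seg x m n.
Proof.
by rewrite /seg /gram; under eq_bigr do rewrite fctE starN mulrNN.
Qed.

Lemma seg_ract x a m n : seg (ract x a) m n <= seg x m n * rnorm a.
Proof.
rewrite seg_le ?mulr_ge0 ?seg_ge0 ?rnorm_ge0 //.
have -> : gram (ract x a) m n = star a * gram x m n * a.
  rewrite /gram mulr_sumr mulr_suml; apply: eq_bigr => i _.
  by rewrite /ract starM !mulrA.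
rewrite exprMn sqr_seg; apply: (le_trans (rnormM _ _)).
rewrite [leRHS]mulrC expr2 -mulrA [leRHS]mulrCA mulrC.
rewrite ler_wpM2l ?rnorm_ge0 //.
by apply: (le_trans (rnormM _ _)); rewrite rnorm_star mulrC.
Qed.

Lemma rnorm_seg x i : rnorm (x i) <= seg x 0 i.+1.
Proof.
have -> : rnorm (x i) = seg x i i.+1.
  by rewrite /seg /gram big_nat1 rnorm_starM sqrtr_sqr ger0_norm ?rnorm_ge0.
exact: seg_sub.
Qed.

Lemma seg_small (X : nat -> nat -> A) x k :
  (forall i, tendsto (X ^~ i) (x i)) ->
  forall e, 0 < e -> exists N, forall n, (N <= n)%N -> seg (X n - x) 0 k <= e.
Proof.
move=> Xx; elim: k => [|k IH] e e0.
  by exists 0%N => n _; rewrite seg_nil // ltW.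
have [N hN] := IH (e / 2) (divr_gt0 e0 (ltr0n _ 2)).
have [N' hN'] := Xx k (e / 2) (divr_gt0 e0 (ltr0n _ 2)).
exists (maxn N N') => n; rewrite geq_max => /andP[/hN h1 /hN' h2].
rewrite (seg_le _ _ _ (ltW e0)) /gram big_nat_recr //= -/(gram _ _ _).
apply: (le_trans (rnormD _ _)); rewrite rnorm_starM -sqr_seg !fctE.
have e2 : 0 <= e / 2 by rewrite divr_ge0 ?ltW.
have : seg (X n - x) 0 k ^+ 2 <= (e / 2) ^+ 2 by rewrite ler_sqr ?nnegrE ?seg_ge0.
have : rnorm (X n k - x k) ^+ 2 <= (e / 2) ^+ 2.
  by rewrite ler_sqr ?nnegrE ?rnorm_ge0 // ltW.
have : 0 <= e ^+ 2 by rewrite exprn_ge0 ?ltW.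
rewrite expr_div_n; lra.
Qed.

(** Cauchy's criterion; as segments are monotone, it suffices to consider those
    that start at [N]. *)
Lemma l2P x : l2 x <-> forall e, 0 < e -> exists N, forall n, seg x N n <= e.
Proof.
have gB m n : (m <= n)%N -> gram x 0 n - gram x 0 m = gram x m n.
  by move=> mn; rewrite /gram (big_cat_nat (leq0n m) mn) /= addrAC subrr add0r.
split=> [/cvg_ex[a /tendstoP xa] e e0|hx].
  have {}xa : tendsto (gram x 0) a := xa.
  have [|N hN] := tendsto_cauchy xa (e := e ^+ 2); first by rewrite exprn_gt0.
  exists N => n; have [nN|Nn] := leqP n N; first by rewrite seg_nil ?ltW.
  rewrite (seg_le _ _ _ (ltW e0)) -gB ?(ltnW Nn) //.
  by have /ltW := hN _ _ (leqnn N) (ltnW Nn).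
rewrite /l2 /=; apply/cvg_ex.
suff [a xa] : exists a, tendsto (gram x 0) a.
  by exists a; apply/tendstoP/xa.
apply: cauchy_tendsto => e e0.
have [|N hN] := hx (Num.sqrt (e / 2)); first by rewrite sqrtr_gt0 divr_gt0.
exists N => n Nn; rewrite gB //.
have := hN n; rewrite seg_le ?sqrtr_ge0 // sqr_sqrtr; last by rewrite divr_ge0 ?ltW.
lra.
Qed.

Lemma l2norm_ge0 x : 0 <= l2norm x.
Proof. exact: sqrtr_ge0. Qed.

Lemma inner_tendsto x : l2 x -> tendsto (gram x 0) (inner x x).
Proof.
move=> lx; have : series (fun i => star (x i) * x i) n @[n --> \oo] --> inner x x.
  exact: lx.
by move/tendstoP.
Qed.

Lemma sqr_l2norm x : l2norm x ^+ 2 = rnorm (inner x x).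
Proof. by rewrite sqr_sqrtr // rnorm_ge0. Qed.

Lemma seg_l2norm x n : l2 x -> seg x 0 n <= l2norm x.
Proof.
move=> lx; rewrite seg_le ?l2norm_ge0 // sqr_l2norm.
apply: (@le_addgt0 _ _ _ 1) => // e e0.
have [N hN] := inner_tendsto lx e0.
have := hN _ (leq_maxr n N); set k := maxn n N => hk.
have : rnorm (gram x 0 n) <= rnorm (gram x 0 k).
  by rewrite -!sqr_seg ler_sqr ?nnegrE ?seg_ge0 // seg_sub // leq_maxl.
have := rnormD (gram x 0 k - inner x x) (inner x x); rewrite subrK; lra.
Qed.

Lemma l2norm_le x r : l2 x -> (forall n, seg x 0 n <= r) -> l2norm x <= r.
Proof.
move=> lx hr; have r0 : 0 <= r by rewrite (le_trans _ (hr 0%N)) ?seg_ge0.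
rewrite -ler_sqr ?nnegrE ?l2norm_ge0 // sqr_l2norm.
apply: (@le_addgt0 _ _ _ 1) => // e e0.
have [N hN] := inner_tendsto lx e0.
have := hr N; rewrite seg_le //; have := hN N (leqnn N).
have := rnormB (gram x 0 N) (gram x 0 N - inner x x); rewrite subKr; lra.
Qed.

Lemma l2D x y : l2 x -> l2 y -> l2 (x + y).
Proof.
move=> /l2P lx /l2P ly; apply/l2P => e e0.
have [N hN] := lx (e / 2) (divr_gt0 e0 (ltr0n _ 2)).
have [N' hN'] := ly (e / 2) (divr_gt0 e0 (ltr0n _ 2)).
exists (maxn N N') => n; apply: (le_trans (segD _ _ _ _)).
have := le_trans (seg_sub x (leq_maxl N N') (leqnn n)) (hN n).
have := le_trans (seg_sub y (leq_maxr N N') (leqnn n)) (hN' n).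
lra.
Qed.

Lemma l2_ract x a : l2 x -> l2 (ract x a).
Proof.
move=> /l2P lx; apply/l2P => e e0.
have a1 : 0 < rnorm a + 1 by rewrite ltr_wpDl ?rnorm_ge0.
have [N hN] := lx (e / (rnorm a + 1)) (divr_gt0 e0 a1).
exists N => n; apply: (le_trans (seg_ract _ _ _ _)).
apply: (@le_trans _ _ (seg x N n * (rnorm a + 1))).
  by rewrite ler_wpM2l ?seg_ge0 // lerDl.
by rewrite -ler_pdivlMr.
Qed.

Lemma l2_0 : l2 (0 : nat -> A).
Proof.
apply/l2P => e e0; exists 0%N => n.
by rewrite /seg /gram big1 ?rnorm0 ?sqrtr0 ?ltW // => i _; rewrite mulr0.
Qed.

Lemma l2N x : l2 x -> l2 (- x).
Proof.
move=> /l2P lx; apply/l2P => e /lx[N hN]; exists N => n; by rewrite segN.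
Qed.

Lemma l2B x y : l2 x -> l2 y -> l2 (x - y).
Proof. by move=> lx ly; apply: l2D => //; exact: l2N. Qed.

Lemma l2normD x y : l2 x -> l2 y -> l2norm (x + y) <= l2norm x + l2norm y.
Proof.
move=> lx ly; apply: l2norm_le => [|n]; first exact: l2D.
by apply: (le_trans (segD _ _ _ _)); rewrite lerD ?seg_l2norm.
Qed.

Lemma l2norm_ract x a : l2 x -> l2norm (ract x a) <= l2norm x * rnorm a.
Proof.
move=> lx; apply: l2norm_le => [|n]; first exact: l2_ract.
by apply: (le_trans (seg_ract _ _ _ _)); rewrite ler_wpM2r ?rnorm_ge0 ?seg_l2norm.
Qed.

Lemma l2normN x : l2norm (- x) = l2norm x.
Proof.
rewrite /l2norm /inner; congr (Num.sqrt (complex.Re `|lim (series _ @ \oo)|)).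
by apply/funext => i; rewrite fctE starN mulrNN.
Qed.

Lemma l2normC x y : l2norm (x - y) = l2norm (y - x).
Proof. by rewrite -l2normN opprB. Qed.

Lemma l2normB x y : l2 x -> l2 y -> l2norm (x - y) <= l2norm x + l2norm y.
Proof.
by move=> lx ly; rewrite -(l2normN y) l2normD //; exact: l2N.
Qed.

Lemma l2norm_sub_le x y z : l2 x -> l2 y -> l2 z ->
  l2norm (x - z) <= l2norm (x - y) + l2norm (y - z).
Proof. by move=> *; rewrite -(subrKA y) l2normD //; exact: l2B. Qed.

Lemma rnorm_l2norm x i : l2 x -> rnorm (x i) <= l2norm x.
Proof. by move=> lx; rewrite (le_trans (rnorm_seg _ _)) // seg_l2norm. Qed.

Lemma l2norm_eq0 x : l2 x -> l2norm x <= 0 -> x = 0.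
Proof.
move=> lx x0; apply/funext => i; apply: rnorm_eq0; apply/eqP.
by rewrite eq_le rnorm_ge0 (le_trans (rnorm_l2norm i lx)).
Qed.

Lemma l2norm0 : l2norm (0 : nat -> A) = 0.
Proof.
apply/eqP; rewrite eq_le l2norm_ge0 andbT; apply: l2norm_le => [|n].
  exact: l2_0.
by rewrite /seg /gram big1 ?rnorm0 ?sqrtr0 // => i _; rewrite mulr0.
Qed.

Lemma halving_le (d : nat -> R) : (forall n, 0 <= d n) ->
  (forall n, d n.+1 <= d n / 2) -> forall n k, d (n + k)%N <= d n / 2 ^+ k.
Proof.
move=> d0 hd n; elim=> [|k IH]; first by rewrite addn0 expr0 divr1.
rewrite addnS; apply: (le_trans (hd _)); rewrite exprSr invfM mulrA.
by rewrite ler_wpM2r ?invr_ge0.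
Qed.

Lemma halving_small (d : nat -> R) e : (forall n, 0 <= d n) ->
  (forall n, d n.+1 <= d n / 2) -> 0 < e ->
  exists N, forall n, (N <= n)%N -> d n < e.
Proof.
move=> d0 hd e0.
have h0 : 0 <= 2^-1 :> R by rewrite invr_ge0.
have h1 : 2^-1 < 1 :> R by rewrite invf_lt1 // ltr1n.
have [N hN] := expr_small (d 0%N) h0 h1 e0.
exists N => n /hN; apply: le_lt_trans.
have := halving_le d0 hd 0 n; rewrite add0n mulrC exprVn.
by [].
Qed.

(** Every Cauchy sequence met below has a rate [d] that is halved at each step, so
    completeness is stated with this rate and an explicit error.  The limit is
    taken coordinatewise, and the estimates are transferred to it on each finite
    segment. *)
Lemma l2_complete (X : nat -> nat -> A) (d : nat -> R) :
  (forall n, l2 (X n)) -> (forall n, d n.+1 <= d n / 2) ->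
  (forall n, l2norm (X n.+1 - X n) <= d n) ->
  exists2 x, l2 x & forall n, l2norm (X n - x) <= 2 * d n.
Proof.
move=> lX hd hX.
have d0 n : 0 <= d n := le_trans (l2norm_ge0 _) (hX n).
have Xk k n : l2norm (X (n + k)%N - X n) <= 2 * d n.
  elim: k n => [|k IH] n; first by rewrite addn0 subrr l2norm0 mulr_ge0.
  rewrite addnS -addSn; apply: (le_trans (l2norm_sub_le (lX _) (lX n.+1) (lX _))).
  have := IH n.+1; have := hX n; have := hd n; lra.
have Xi i : exists a, tendsto (X ^~ i) a.
  apply: cauchy_tendsto => e e0.
  have [|N hN] := halving_small d0 hd (e := e / 2); first by rewrite divr_gt0.
  exists N => n Nn; rewrite -(subnKC Nn).
  have := rnorm_l2norm i (l2B (lX (N + (n - N))%N) (lX N)).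
  have := Xk (n - N)%N N; have := hN N (leqnn N); rewrite fctE; lra.
have [x Xx] := choice Xi.
have hx n k : seg (X n - x) 0 k <= 2 * d n.
  apply: (@le_addgt0 _ _ _ 1) => // e e0.
  have [N hN] := seg_small k Xx e0.
  rewrite -(subrKA (X (n + N)%N)); apply: (le_trans (segD _ _ _ _)).
  have := hN (n + N)%N (leq_addl _ _).
  have := seg_l2norm k (l2B (lX (n + N)%N) (lX n)).
  have := Xk N n; rewrite -segN opprB; lra.
have lx : l2 x.
  apply/l2P => e e0.
  have [|n hn] := halving_small d0 hd (e := e / 4); first by rewrite divr_gt0.
  have [|N hN] := (l2P (X n)).1 (lX n) (e / 2); first by rewrite divr_gt0.
  exists N => k; rewrite -[x](subKr (X n)); apply: (le_trans (segD _ _ _ _)).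
  rewrite segN; have := hN k; have := hn n (leqnn n); have := hx n k.
  have := seg_sub (X n - x) (leq0n N) (leqnn k); lra.
exists x => // n; apply: l2norm_le => //; exact: l2B.
Qed.

End L2.

(** * Boundedness of projections *)
Section Decomp.
Variables (R : realType) (A : unitalCStarType R).
Implicit Types (a b c : A) (r s t e : R) (x y z m n : nat -> A) (k i j : nat).
Implicit Types (M N : set (nat -> A)).
Local Notation rs := (rs A).

Lemma ractD x y a : ract (x + y) a = ract x a + ract y a.
Proof. by apply/funext => i; rewrite /ract !fctE mulrDl. Qed.

Lemma ractN x a : ract (- x) a = - ract x a.
Proof. by apply/funext => i; rewrite /ract !fctE mulNr. Qed.

Lemma ractB x y a : ract (x - y) a = ract x a - ract y a.
Proof. by rewrite ractD ractN. Qed.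

Lemma ractA x a b : ract (ract x a) b = ract x (a * b).
Proof. by apply/funext => i; rewrite /ract mulrA. Qed.

Lemma ract1 x : ract x 1 = x.
Proof. by apply/funext => i; rewrite /ract mulr1. Qed.

Lemma ractN1 x : ract x (-1) = - x.
Proof. by apply/funext => i; rewrite /ract mulrN1. Qed.

Lemma ract0 x : ract x 0 = 0.
Proof. by apply/funext => i; rewrite /ract mulr0. Qed.

Lemma l2norm_ract_rs x t : 0 <= t -> l2 x -> l2norm (ract x (rs t)) <= t * l2norm x.
Proof.
move=> t0 lx; apply: (le_trans (l2norm_ract _ lx)); rewrite mulrC.
rewrite ler_wpM2r ?l2norm_ge0 //; apply: (le_trans (rnorm_rs _ _)).
by rewrite ger0_norm.
Qed.

Lemma closed_submodule_l2 M x : closed_submodule M -> M x -> l2 x.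
Proof. by case=> + _ _ _ _; apply. Qed.

Lemma closed_submodule0 M : closed_submodule M -> M 0.
Proof. by case. Qed.

Lemma closed_submoduleD M x y : closed_submodule M -> M x -> M y -> M (x + y).
Proof. by case=> _ _ + _ _; apply. Qed.

Lemma closed_submodule_ract M x a : closed_submodule M -> M x -> M (ract x a).
Proof. by case=> _ _ _ + _; apply. Qed.

Lemma closed_submoduleN M x : closed_submodule M -> M x -> M (- x).
Proof. by move=> cM Mx; rewrite -ractN1; exact: closed_submodule_ract. Qed.

Lemma closed_submoduleB M x y : closed_submodule M -> M x -> M y -> M (x - y).
Proof.
by move=> cM Mx My; apply: closed_submoduleD => //; exact: closed_submoduleN.
Qed.

Lemma direct_sum_inj M N m n m' n' : direct_sum_decomp M N ->
  M m -> N n -> M m' -> N n' -> m + n = m' + n' -> m = m' /\ n = n'.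
Proof.
move=> [cM cN MN _] Mm Nn Mm' Nn' e.
have e' : m - m' = n' - n.
  by rewrite -[m](addrK n) e [m' + n']addrC addrAC addrK.
have : (M `&` N) (m - m').
  split; first exact: closed_submoduleB.
  by rewrite e'; exact: closed_submoduleB.
rewrite MN /= => mm; have em : m = m' by apply/eqP; rewrite -subr_eq0 mm.
by split => //; move: e; rewrite em => /addrI.
Qed.

Lemma direct_sum_l2 M N m n : direct_sum_decomp M N -> M m -> N n -> l2 (m + n).
Proof.
move=> [cM cN _ _] Mm Nn; apply: l2D; first exact: (closed_submodule_l2 cM).
exact: (closed_submodule_l2 cN).
Qed.

(** Baire's argument: the sets [{m + n : |m|, |n| <= k}] cover [l2], so one of
    them is dense in a ball.  Otherwise the balls [S k] built below avoid
    them one after the other and shrink to a point that is in none. *)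
Lemma direct_sum_baire M N : direct_sum_decomp M N ->
  exists k x0 r, [/\ l2 x0, 0 < r & forall x, l2 x -> l2norm (x - x0) < r ->
    forall e, 0 < e -> exists m n, [/\ M m, N n, l2norm m <= k%:R,
      l2norm n <= k%:R & l2norm (x - (m + n)) < e]].
Proof.
move=> MN; have [cM cN _ tot] := MN.
apply: contrapT => nodense.
pose P (s : (nat -> A) * R) := l2 s.1 /\ 0 < s.2.
pose Q k (s s' : (nat -> A) * R) := [/\ P s', s'.2 <= s.2 / 2,
  l2norm (s'.1 - s.1) <= s.2 & forall m n, M m -> N n -> l2norm m <= k%:R ->
  l2norm n <= k%:R -> 2 * s'.2 < l2norm (s'.1 - (m + n))].
have step (ks : nat * ((nat -> A) * R)) :
    exists s' : (nat -> A) * R, P ks.2 -> Q ks.1 ks.2 s'.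
  case: ks => k [x0 r] /=; apply: contrapT => nos'.
  have [Ps|nPs] := pselect (P (x0, r)); last by apply: nos'; exists (x0, r).
  have [/= lx0 r0] := Ps.
  apply: nodense; exists k, x0, r; split => // x lx xx0 e e0.
  (* A quarter: the new ball, of radius at most r / 2, even when doubled avoids
     the k-th set, and the limit is within twice the radius. *)
  apply: contrapT => nomn; apply: nos'; exists (x, Num.min r e / 4) => _.
  have mr : Num.min r e <= r by rewrite ge_min lexx.
  have me : Num.min r e <= e by rewrite ge_min lexx orbT.
  have m0 : 0 < Num.min r e by rewrite lt_min r0.
  split => /=; [by split => //=; rewrite divr_gt0|lra|exact: ltW|].
  move=> m n Mm Nn mk nk; rewrite ltNge; apply/negP => le.
  by apply: nomn; exists m, n; split => //; lra.
have [f hf] := choice step.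
pose fix S j : (nat -> A) * R := if j is k.+1 then f (k, S k) else (0, 1).
have PS j : P (S j).
  elim: j => [|j IH]; first by split => //; exact: l2_0.
  by have [] := hf (j, S j) IH.
have QS j : Q j (S j) (S j.+1) by exact: hf (j, S j) (PS j).
have [x lx hx] : exists2 x, l2 x & forall j, l2norm ((S j).1 - x) <= 2 * (S j).2.
  apply: (@l2_complete _ _ (fun j => (S j).1) (fun j => (S j).2)) => j.
  - by have [] := PS j.
  - by have [] := QS j.
  - by have [] := QS j.
have [m [n [Mm Nn xE]]] := tot x lx.
pose k := Num.bound (l2norm m + l2norm n).
have kle : l2norm m + l2norm n <= k%:R.
  by apply/ltW/archi_boundP; rewrite addr_ge0 ?l2norm_ge0.
have mk : l2norm m <= k%:R by have := l2norm_ge0 n; lra.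
have nk : l2norm n <= k%:R by have := l2norm_ge0 m; lra.
have [_ _ _ /(_ m n Mm Nn mk nk)] := QS k.
by rewrite -xE ltNge hx.
Qed.

(** By symmetry and convexity the ball can be centred at the origin: [x'] is half
    the difference of [x0 + x'] and [x0 - x'].  The scaling then reaches every
    [x]. *)
Lemma direct_sum_approx M N : direct_sum_decomp M N ->
  exists2 c : R, 0 <= c & forall x, l2 x -> exists m n, [/\ M m, N n,
    l2norm m <= c * l2norm x, l2norm n <= c * l2norm x
    & l2norm (x - (m + n)) <= l2norm x / 2].
Proof.
move=> MN; have [cM cN _ _] := MN.
have [k [x0 [r [lx0 r0 dense]]]] := direct_sum_baire MN.
exists (2 * k%:R / r) => [|x lx]; first by rewrite divr_ge0 ?mulr_ge0 // ltW.
have [x_le0|t0] := leP (l2norm x) 0.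
  have -> : x = 0 by exact: l2norm_eq0.
  exists 0, 0; rewrite l2norm0 !mulr0 mul0r addr0 subr0 l2norm0.
  by split => //; exact: closed_submodule0.
set t := l2norm x in t0 *; pose x' := ract x (rs (r / (2 * t))).
have lx' : l2 x' by exact: l2_ract.
have x'r : l2norm x' < r.
  have q0 : 0 <= r / (2 * t) by rewrite divr_ge0 ?mulr_ge0 // ltW.
  apply: (le_lt_trans (l2norm_ract_rs q0 lx)); rewrite -/t.
  have -> : r / (2 * t) * t = r / 2 by field; rewrite gt_eqF.
  lra.
have e0 : 0 < r / 4 by rewrite divr_gt0.
have [||m1 [n1 [Mm1 Nn1 m1k n1k h1]]] := dense (x0 + x') _ _ _ e0.
- exact: l2D.
- by rewrite addrAC subrr add0r.
have [||m2 [n2 [Mm2 Nn2 m2k n2k h2]]] := dense (x0 - x') _ _ _ e0.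
- exact: l2B.
- by rewrite addrAC subrr add0r l2normN.
have q0 : 0 <= t / r by rewrite divr_ge0 // ltW.
have lM := closed_submodule_l2 cM; have lN := closed_submodule_l2 cN.
have bnd u v : l2 u -> l2 v -> l2norm u <= k%:R -> l2norm v <= k%:R ->
    l2norm (ract (u - v) (rs (t / r))) <= 2 * k%:R / r * t.
  move=> lu lv uk vk; apply: (le_trans (l2norm_ract_rs q0 (l2B lu lv))).
  have -> : 2 * k%:R / r * t = t / r * (2 * k%:R) by field; rewrite gt_eqF.
  by rewrite ler_wpM2l //; have := l2normB lu lv; lra.
exists (ract (m1 - m2) (rs (t / r))), (ract (n1 - n2) (rs (t / r))); split.
- by apply: closed_submodule_ract => //; exact: closed_submoduleB.
- by apply: closed_submodule_ract => //; exact: closed_submoduleB.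
- by apply: bnd => //; exact: lM.
- by apply: bnd => //; exact: lN.
have l1 : l2 (x0 + x' - (m1 + n1)).
  by apply: l2B; [exact: l2D|exact: (direct_sum_l2 MN)].
have l2' : l2 (x0 - x' - (m2 + n2)).
  by apply: l2B; [exact: l2B|exact: (direct_sum_l2 MN)].
have -> : x - (ract (m1 - m2) (rs (t / r)) + ract (n1 - n2) (rs (t / r))) =
    ract ((x0 + x' - (m1 + n1)) - (x0 - x' - (m2 + n2))) (rs (t / r)).
  have xE : x = ract (x' + x') (rs (t / r)).
    rewrite ractD !ractA -!rsM; apply/funext => i; rewrite !fctE /ract -mulrDr -rsD.
    rewrite [_ + _](_ : _ = 1) ?rs1 ?mulr1 //.
    by field; rewrite !gt_eqF.
  rewrite -ractD [in LHS]xE -ractB; congr (ract _ _).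
  have BB (a b c d : nat -> A) : (a - b) - (c - d) = (a - c) - (b - d).
    by rewrite opprD addrACA -opprD.
  have e1 : x0 + x' - (x0 - x') = x' + x' by rewrite opprB addrC addrA subrK.
  by rewrite BB e1 (opprD m2) (addrACA m1).
apply: (le_trans (l2norm_ract_rs q0 (l2B l1 l2'))).
have -> : t / 2 = t / r * (r / 2) by field; rewrite gt_eqF.
by rewrite ler_wpM2l //; have := l2normB l1 l2'; lra.
Qed.

(** Bounded inverse theorem for the addition [M x N -> l2]: the approximations
    are summed up, and the sums converge in [M] and in [N]. *)
Lemma direct_sum_bound M N : direct_sum_decomp M N ->
  exists2 c : R, 0 <= c & forall m n, M m -> N n -> l2norm m <= c * l2norm (m + n).
Proof.
move=> MN; have [cM cN _ _] := MN.
have [c c0 happ] := direct_sum_approx MN.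
have lM := closed_submodule_l2 cM; have lN := closed_submodule_l2 cN.
have step x : exists mn : (nat -> A) * (nat -> A), l2 x -> [/\ M mn.1, N mn.2,
    l2norm mn.1 <= c * l2norm x, l2norm mn.2 <= c * l2norm x
    & l2norm (x - (mn.1 + mn.2)) <= l2norm x / 2].
  have [lx|nlx] := pselect (l2 x); last by exists (0, 0).
  by have [m [n h]] := happ x lx; exists (m, n).
have [f hf] := choice step.
exists (2 * c) => [|m n Mm Nn]; first exact: mulr_ge0.
set x := m + n; have lx : l2 x := direct_sum_l2 MN Mm Nn.
pose X k := iter k (fun y : nat -> A => y - ((f y).1 + (f y).2)) x.
have lX k : l2 (X k).
  elim: k => [//|k IH]; have [h1 h2 _ _ _] := hf _ IH.
  by apply: l2B => //; exact: (direct_sum_l2 MN).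
pose d k := c * l2norm (X k).
have Xhalf k : l2norm (X k.+1) <= l2norm (X k) / 2 by have [] := hf _ (lX k).
have dhalf k : d k.+1 <= d k / 2 by rewrite /d -mulrA ler_wpM2l.
have Xe e : 0 < e -> exists k, l2norm (X k) < e.
  move=> e0; have [k hk] := halving_small (fun k => l2norm_ge0 (X k)) Xhalf e0.
  by exists k; exact: hk.
have lim (K : set (nat -> A)) (g : (nat -> A) -> nat -> A) : closed_submodule K ->
    (forall k, K (g (X k)) /\ l2norm (g (X k)) <= d k) ->
    exists2 y, K y & forall k, l2norm (\sum_(i < k) g (X i) - y) <= 2 * d k.
  move=> cK hg.
  have KS k : K (\sum_(i < k) g (X i)).
    elim/big_ind: _ => [|u v|i _]; [exact: closed_submodule0| |by have [] := hg i].
    exact: closed_submoduleD.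
  have lK := closed_submodule_l2 cK.
  have [|||y ly hy] := @l2_complete _ _ (fun k => \sum_(i < k) g (X i)) d.
  - by move=> k; exact: lK.
  - exact: dhalf.
  - by move=> k; rewrite big_ord_recr /= addrAC subrr add0r; have [] := hg k.
  exists y => //; case: cK => _ _ _ _; apply => // e e0.
  have c1 : 0 < 2 * c + 1 by rewrite ltr_wpDl // mulr_ge0.
  have [k hk] := Xe (e / (2 * c + 1)) (divr_gt0 e0 c1).
  exists (\sum_(i < k) g (X i)) => //; rewrite l2normC.
  apply: (le_lt_trans (hy k)); rewrite /d mulrA.
  apply: (@le_lt_trans _ _ ((2 * c + 1) * l2norm (X k))).
    by rewrite ler_wpM2r ?l2norm_ge0 // lerDl.
  by rewrite mulrC -ltr_pdivlMr.
have [k|m' Mm' hm'] := lim M (fun y => (f y).1) cM.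
  by have [] := hf _ (lX k).
have [k|n' Nn' hn'] := lim N (fun y => (f y).2) cN.
  by have [] := hf _ (lX k).
have xS k : x = X k + (\sum_(i < k) (f (X i)).1 + \sum_(i < k) (f (X i)).2).
  elim: k => [|k IH]; first by rewrite !big_ord0 !addr0.
  have -> : X k.+1 = X k - ((f (X k)).1 + (f (X k)).2) by [].
  by rewrite !big_ord_recr /= (addrACA (\sum_(i < k) _)) [X in _ = _ + X]addrC
             [RHS]addrA subrK.
have lx' : l2 (m' + n') := direct_sum_l2 MN Mm' Nn'.
have xE : x = m' + n'.
  apply/eqP; rewrite -subr_eq0; apply/eqP; apply: l2norm_eq0; first exact: l2B.
  have c1 : 0 <= 1 + 4 * c by rewrite addr_ge0 // mulr_ge0.
  apply: (le_addgt0 c1) => e e0; have [k hk] := Xe e e0.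
  set u := \sum_(i < k) (f (X i)).1; set v := \sum_(i < k) (f (X i)).2.
  have Mu : M u.
    rewrite /u; elim/big_ind: _ => [|? ? |i _]; first exact: closed_submodule0.
      exact: closed_submoduleD.
    by have [] := hf _ (lX i).
  have Nv : N v.
    rewrite /v; elim/big_ind: _ => [|? ? |i _]; first exact: closed_submodule0.
      exact: closed_submoduleD.
    by have [] := hf _ (lX i).
  rewrite (xS k) -/u -/v -addrA opprD addrACA.
  have l1 : l2 (u - m') by apply: l2B; exact: lM.
  have l2' : l2 (v - n') by apply: l2B; exact: lN.
  apply: (le_trans (l2normD (lX k) (l2D l1 l2'))).
  have := l2normD l1 l2'; have := hm' k; have := hn' k; rewrite -/u -/v /d.
  have : c * l2norm (X k) <= c * e by rewrite ler_wpM2l // ltW.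
  lra.
have [mE _] := direct_sum_inj MN Mm Nn Mm' Nn' xE.
by have := hm' 0%N; rewrite big_ord0 sub0r l2normN /d mulrA mE.
Qed.

End Decomp.

(** * Projections and inverses *)
Section Linear.
Variables (R : realType) (A : unitalCStarType R).
Implicit Types (a b c : A) (r s t e : R) (x y z : nat -> A).
Implicit Types (M N K : set (nat -> A)) (f g : (nat -> A) -> nat -> A).
Local Notation rs := (rs A).

Lemma closed_submodule_setl2 : closed_submodule (@l2 R A).
Proof.
split=> //; first exact: l2_0; [exact: l2D|exact: l2_ract].
Qed.

Lemma linear_on_sub M K f : M `<=` K -> linear_on K f -> linear_on M f.
Proof.
by move=> MK [fD fZ]; split=> [x y /MK Kx /MK Ky|x a /MK Kx]; [exact: fD|exact: fZ].
Qed.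

Lemma linear_onB K f x y : closed_submodule K -> linear_on K f -> K x -> K y ->
  f (x - y) = f x - f y.
Proof.
move=> cK [fD fZ] Kx Ky; rewrite fD //; last exact: closed_submoduleN.
by rewrite -(ractN1 y) fZ // ractN1.
Qed.

Lemma linear_on0 K f : closed_submodule K -> linear_on K f -> f 0 = 0.
Proof.
move=> cK lf; have K0 := closed_submodule0 cK.
by have := linear_onB cK lf K0 K0; rewrite !subrr.
Qed.

Lemma direct_sum_sym M N : direct_sum_decomp M N -> direct_sum_decomp N M.
Proof.
move=> [cM cN MN tot]; split=> //; first by rewrite setIC.
by move=> x /tot[m [n [Mm Nn ->]]]; exists n, m; split=> //; rewrite addrC.
Qed.

Definition is_proj M N f :=
  [/\ linear_on (@l2 R A) f, forall x, l2 x -> M (f x), forall x, l2 x -> N (x - f x)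
    & forall m n, M m -> N n -> f (m + n) = m].

Lemma direct_sum_proj M N : direct_sum_decomp M N -> exists f, is_proj M N f.
Proof.
move=> MN; have [cM cN _ tot] := MN.
have /choice[f hf] : forall x, exists m, l2 x -> M m /\ N (x - m).
  move=> x; have [lx|nlx] := pselect (l2 x); last by exists 0.
  have [m [n [Mm Nn ->]]] := tot x lx; exists m => _; split=> //.
  by rewrite addrAC subrr add0r.
have fE m n : M m -> N n -> f (m + n) = m.
  move=> Mm Nn; have [Mf Nf] := hf _ (direct_sum_l2 MN Mm Nn).
  by have [] := direct_sum_inj MN Mf Nf Mm Nn; rewrite // addrC subrK.
exists f; split => //; [split=> [x y lx ly|x a lx]|by move=> x /hf[]..].
- have [Mx Nx] := hf _ lx; have [My Ny] := hf _ ly.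
  have xyE : x + y = (f x + f y) + ((x - f x) + (y - f y)).
    by rewrite addrACA !subrKC.
  by rewrite [in LHS]xyE fE //; exact: closed_submoduleD.
- have [Mx Nx] := hf _ lx; rewrite -{1}(subrKC (f x) x) ractD.
  by rewrite fE //; exact: closed_submodule_ract.
Qed.

Lemma proj_id M N f m : closed_submodule N -> is_proj M N f -> M m -> f m = m.
Proof.
by move=> cN [_ _ _ fE] Mm; rewrite -[m in LHS]addr0 fE //; case: cN.
Qed.

Lemma proj_eq0 M N f n : closed_submodule M -> is_proj M N f -> N n -> f n = 0.
Proof. by move=> cM [_ _ _ fE] Nn; rewrite -[n]add0r fE //; case: cM. Qed.

Lemma proj_bound M N f : direct_sum_decomp M N -> is_proj M N f ->
  exists2 c : R, 0 <= c & forall x, l2 x -> l2norm (f x) <= c * l2norm x.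
Proof.
move=> MN [_ Mf Nf _]; have [c c0 hc] := direct_sum_bound MN.
exists c => // x lx; have := hc _ _ (Mf x lx) (Nf x lx).
by rewrite addrC subrK.
Qed.

Lemma hilbert_iso_inv M N f : hilbert_iso M N f ->
  exists g, forall y, N y -> M (g y) /\ f (g y) = y.
Proof.
move=> [_ [_ _ surj] _ _].
have /choice[g hg] : forall y, exists x, N y -> M x /\ f x = y.
  move=> y; have [Ny|nNy] := pselect (N y); last by exists 0.
  by have [x Mx fx] := surj y Ny; exists x.
by exists g.
Qed.

Lemma hilbert_iso_injective M N f x y : hilbert_iso M N f -> M x -> M y ->
  f x = f y -> x = y.
Proof. by move=> [_ [_ inj _] _ _] Mx My; apply: inj; rewrite inE. Qed.

Lemma hilbert_iso_inv_linear M N f g : closed_submodule M -> closed_submodule N ->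
  hilbert_iso M N f -> (forall y, N y -> M (g y) /\ f (g y) = y) ->
  linear_on N g.
Proof.
move=> cM cN fi hg; have [[fD fZ] _ _ _] := fi.
split=> [x y Nx Ny|x a Nx].
  have [Mx fx] := hg x Nx; have [My fy] := hg y Ny.
  have [Mxy fxy] := hg _ (closed_submoduleD cN Nx Ny).
  apply: (hilbert_iso_injective fi) => //; first exact: closed_submoduleD.
  by rewrite fD // fx fy.
have [Mx fx] := hg x Nx; have [Mxa fxa] := hg _ (closed_submodule_ract a cN Nx).
apply: (hilbert_iso_injective fi) => //; first exact: closed_submodule_ract.
by rewrite fZ // fx.
Qed.

(** * Finite generation *)

Lemma fg_image N f : closed_submodule N -> linear_on N f ->
  finitely_generated N -> finitely_generated (f @` N).
Proof.
move=> cN lf [n [g NE]]; exists n, (f \o g).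
have Ng i : N (g i).
  rewrite NE /=; exists (fun j => if j == i then 1 else 0).
  rewrite (bigD1 i) //= eqxx ract1 big1 ?addr0 // => j /negPf ->.
  by rewrite ract0.
have fS (a : 'I_n -> A) :
    f (\sum_(i < n) ract (g i) (a i)) = \sum_(i < n) ract (f (g i)) (a i).
  pose P u v := N u /\ f u = v.
  suff [] : P (\sum_(i < n) ract (g i) (a i)) (\sum_(i < n) ract (f (g i)) (a i)).
    by [].
  apply: (big_rec2 P) => [|i y1 y2 _ [Ny <-]]; rewrite /P.
    by split; [exact: closed_submodule0|exact: (linear_on0 cN lf)].
  have Nga := closed_submodule_ract (a i) cN (Ng i).
  by case: lf => fD fZ; split; [exact: closed_submoduleD|rewrite fD // fZ].
apply/seteqP; split=> [_ [x + <-]|_ [a ->]].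
  by rewrite {1}NE => -[a ->]; exists a; rewrite fS.
by exists (\sum_(i < n) ract (g i) (a i)) => //; rewrite NE; exists a.
Qed.

Lemma fg_sum M N : finitely_generated M -> finitely_generated N ->
  finitely_generated [set x + y | x in M & y in N].
Proof.
move=> [m [g ->]] [n [h ->]].
exists (m + n)%N, (fun i => match fintype.split i with inl j => g j | inr j => h j end).
have sE (a : 'I_m -> A) (b : 'I_n -> A) :
  \sum_(i < m) ract (g i) (a i) + \sum_(i < n) ract (h i) (b i) =
  \sum_(i < m + n) ract (match fintype.split i with inl j => g j | inr j => h j end)
    (match fintype.split i with inl j => a j | inr j => b j end).
  rewrite big_split_ord /=; congr (_ + _); apply: eq_bigr => i _.
    by rewrite -[lshift _ _]/(unsplit (inl i)) unsplitK.
  by rewrite -[rshift _ _]/(unsplit (inr i)) unsplitK.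
apply/seteqP; split=> [_ [_ [a ->] [_ [b ->] <-]]|_ [a ->]].
  by rewrite sE; eexists.
exists (\sum_(i < m) ract (g i) (a (lshift n i))); first by eexists.
exists (\sum_(i < n) ract (h i) (a (rshift m i))); first by eexists.
rewrite sE; apply: eq_bigr => i _; congr (ract _ _).
by rewrite -[in RHS](splitK i); case: (fintype.split i).
Qed.

Lemma fg_span K M N f g : closed_submodule K ->
  closed_submodule M -> closed_submodule N ->
  linear_on M f -> linear_on N g -> finitely_generated M -> finitely_generated N ->
  (forall x, M x -> K (f x)) -> (forall x, N x -> K (g x)) ->
  (forall z, K z -> exists x y, [/\ M x, N y & z = f x + g y]) ->
  finitely_generated K.
Proof.
move=> cK cM cN lf lg gM gN Kf Kg KE.
suff -> : K = [set x + y | x in f @` M & y in g @` N].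
  by apply: fg_sum; apply: fg_image.
apply/seteqP; split=> [z /KE[x [y [Mx Ny ->]]]|_ [_ [x Mx <-] [_ [y Ny <-] <-]]].
  by exists (f x); [exists x|exists (g y) => //; exists y].
by apply: closed_submoduleD => //; [exact: Kf|exact: Kg].
Qed.

(** The projection onto [N'] along [M] maps [N] onto [N']. *)
Lemma fg_complement M N N' : direct_sum_decomp M N -> direct_sum_decomp M N' ->
  finitely_generated N -> finitely_generated N'.
Proof.
move=> MN MN' gN; have [cM cN _ tot] := MN; have [_ cN' _ _] := MN'.
have [q qP] := direct_sum_proj (direct_sum_sym MN'); have [lq N'q _ _] := qP.
have lN : N `<=` @l2 R A by move=> x; exact: closed_submodule_l2.
have lqN := linear_on_sub lN lq.
suff -> : N' = q @` N by exact: fg_image.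
apply/seteqP; split=> [z N'z|_ [x Nx <-]]; last by apply: N'q; exact: lN.
have [m [n [Mm Nn zE]]] := tot z (closed_submodule_l2 cN' N'z).
exists n => //; rewrite -[RHS](proj_id cM qP N'z) zE (proj1 lq).
- by rewrite (proj_eq0 cN' qP Mm) add0r.
- exact: closed_submodule_l2 Mm.
- exact: lN.
Qed.

Section Index.
Variables (G : Ba A) (M1 N1 M2 N2 M1' N1' M2' N2' : set (nat -> A)).
Hypotheses (D : MPhi_decomp G M1 N1 M2 N2) (D' : MPhi_decomp G M1' N1' M2' N2').
Hypotheses (gN1 : finitely_generated N1) (gN2 : finitely_generated N2).

Let GD x y : l2 x -> l2 y -> G (x + y) = G x + G y.
Proof. by case: (Ba_linear G) => + _; apply. Qed.

(** Write [z] in [N1'] as [m + n].  Then [m] is recovered from [G z] in [N2'], as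
    the preimage in [M1] of its component in [M2]; so [z] is the sum of the
    projections to [N1'] of an element coming from [N2'] and of [n] in [N1]. *)
Lemma fg_kernel_part : finitely_generated N2' -> finitely_generated N1'.
Proof.
move=> gN2'.
have [MN1 MN2 GM1 GN1 iG] := D; have [MN1' MN2' GM1' GN1' _] := D'.
have [cM1 cN1 _ tot1] := MN1; have [cM2 cN2 _ _] := MN2.
have [cM1' cN1' _ _] := MN1'; have [_ cN2' _ _] := MN2'.
have [q qP] := direct_sum_proj (direct_sum_sym MN1'); have [lq N1q _ _] := qP.
have [p pP] := direct_sum_proj MN2; have [lp M2p _ pE] := pP.
have [s sP] := hilbert_iso_inv iG.
have ls := hilbert_iso_inv_linear cM1 cM2 iG sP.
have lN1 : N1 `<=` @l2 R A by move=> x; exact: closed_submodule_l2.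
have lM1 : M1 `<=` @l2 R A by move=> x; exact: closed_submodule_l2.
have lN2' : N2' `<=` @l2 R A by move=> x; exact: closed_submodule_l2.
have M1s x : l2 x -> M1 (s (p x)) by move=> lx; have [] := sP _ (M2p x lx).
apply: (fg_span (K := N1') (f := q) (g := fun x => q (s (p x))) cN1' cN1 cN2').
- exact: linear_on_sub lN1 lq.
- apply: linear_on_sub lN2' _; split=> [x y lx ly|x a lx].
    by rewrite (proj1 lp) // (proj1 ls) ?(proj1 lq) //;
      [exact: lM1 (M1s _ _)|exact: lM1 (M1s _ _)|exact: M2p|exact: M2p].
  by rewrite (proj2 lp) // (proj2 ls) ?(proj2 lq) //;
    [exact: lM1 (M1s _ _)|exact: M2p].
- by [].
- by [].
- by move=> x /lN1; exact: N1q.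
- by move=> x /lN2' /M1s /lM1; exact: N1q.
move=> z N1z; have lz := closed_submodule_l2 cN1' N1z.
have [m [n [Mm Nn zE]]] := tot1 z lz.
exists n, (G z); split=> //; first by apply: GN1'; exists z.
have Gm : M2 (G m) by apply: GM1; exists m.
have Gn : N2 (G n) by apply: GN1; exists n.
have -> : s (p (G z)) = m.
  rewrite zE GD ?pE //; [|exact: lM1|exact: lN1].
  have [Ms Gs] := sP _ Gm; exact: (hilbert_iso_injective iG).
rewrite -(proj1 lq) ?[n + m]addrC -?zE; [|exact: lN1|exact: lM1].
by rewrite (proj_id cM1' qP).
Qed.

(** Write [z] in [N2'] as [G m + w] with [m] in [M1] and [w] in [N2], and split [m]
    along [M1' + N1']: modulo [M2'], [z] is the sum of the image of an element of
    [N1'] and of [w]. *)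
Lemma fg_cokernel_part : finitely_generated N1' -> finitely_generated N2'.
Proof.
move=> gN1'.
have [MN1 MN2 GM1 GN1 iG] := D; have [MN1' MN2' GM1' GN1' _] := D'.
have [cM1 cN1 _ _] := MN1; have [cM2 cN2 _ tot2] := MN2.
have [cM1' cN1' _ tot1'] := MN1'; have [cM2' cN2' _ _] := MN2'.
have [q qP] := direct_sum_proj (direct_sum_sym MN2'); have [lq N2q _ _] := qP.
have [s sP] := hilbert_iso_inv iG.
have lN1' : N1' `<=` @l2 R A by move=> x; exact: closed_submodule_l2.
have lM1' : M1' `<=` @l2 R A by move=> x; exact: closed_submodule_l2.
have lN2 : N2 `<=` @l2 R A by move=> x; exact: closed_submodule_l2.
have lG x : l2 x -> l2 (G x) by exact: Ba_l2.
apply: (fg_span (K := N2') (f := fun x => q (G x)) (g := q) cN2' cN1' cN2).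
- apply: linear_on_sub lN1' _; split=> [x y lx ly|x a lx].
    by rewrite GD // (proj1 lq) //; exact: lG.
  by rewrite (proj2 (Ba_linear G)) // (proj2 lq) //; exact: lG.
- exact: linear_on_sub lN2 lq.
- by [].
- by [].
- by move=> x /lN1' /lG; exact: N2q.
- by move=> x /lN2; exact: N2q.
move=> z N2z; have lz := closed_submodule_l2 cN2' N2z.
have [y [w [My Nw zE]]] := tot2 z lz.
have [Ms Gs] := sP y My; have ls := closed_submodule_l2 cM1 Ms.
have [m [n [Mm Nn sE]]] := tot1' _ ls.
exists n, w; split=> //.
have yE : y = G m + G n by rewrite -Gs sE GD //; [exact: lM1'|exact: lN1'].
have lm : l2 (G m) by apply/lG/lM1'.
have ln : l2 (G n) by apply/lG/lN1'.
rewrite -(proj_id cM2' qP N2z) zE yE (proj1 lq) ?(proj1 lq) //; last first.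
- exact: lN2.
- exact: l2D.
rewrite (proj_eq0 cN2' qP) ?add0r //; by apply: GM1'; exists m.
Qed.

End Index.

End Linear.

(** * Perturbation of a decomposition *)
Section Perturbation.
Variables (R : realType) (A : unitalCStarType R).
Implicit Types (a b c : A) (r s t e : R) (x y z : nat -> A).
Implicit Types (M N K : set (nat -> A)) (F G : Ba A) (f g p : (nat -> A) -> nat -> A).
Local Notation rs := (rs A).

Lemma Ba_bound F :
  exists2 c : R, 0 <= c & forall x, l2 x -> l2norm (F x) <= c * l2norm x.
Proof.
have [c hc] := Ba_bounded F; exists `|c| => // x lx.
by apply: (le_trans (hc x lx)); rewrite ler_wpM2r ?l2norm_ge0 ?ler_norm.
Qed.

Lemma BaB F x y : l2 x -> l2 y -> F (x - y) = F x - F y.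
Proof.
exact: linear_onB (closed_submodule_setl2 A) (Ba_linear F).
Qed.

(** The supremum is over the unit ball; [x] is scaled into it. *)
Lemma opdist_bound F G x : l2 x -> l2norm (F x - G x) <= opdist F G * l2norm x.
Proof.
move=> lx; have FGl2 y : l2 y -> l2 (F y - G y).
  by move=> ly; apply: l2B; exact: Ba_l2.
have [x_le0|x_gt0] := leP (l2norm x) 0.
  have -> : x = 0 by exact: l2norm_eq0.
  have Z (H : Ba A) : H 0 = 0.
    exact: linear_on0 (closed_submodule_setl2 A) (Ba_linear H).
  by rewrite !Z subrr l2norm0 mulr0.
set t := l2norm x in x_gt0 *; pose x' := ract x (rs t^-1).
have lx' : l2 x' by exact: l2_ract.
have x'1 : l2norm x' <= 1.
  have ti : 0 <= t^-1 by rewrite invr_ge0 ltW.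
  by apply: (le_trans (l2norm_ract_rs ti lx)); rewrite -/t mulVf ?gt_eqF.
have le1 : l2norm (F x' - G x') <= opdist F G.
  apply: ub_le_sup; last by exists x'.
  have [cF cF0 hF] := Ba_bound F; have [cG cG0 hG] := Ba_bound G.
  exists (cF + cG) => _ [y [ly y1] <-].
  apply: (le_trans (l2normB (@Ba_l2 _ _ F _ ly) (@Ba_l2 _ _ G _ ly))).
  rewrite lerD //; [apply: (le_trans (hF y ly))|apply: (le_trans (hG y ly))];
    by rewrite ler_piMr.
have -> : F x - G x = ract (F x' - G x') (rs t).
  have [_ FZ] := Ba_linear F; have [_ GZ] := Ba_linear G.
  rewrite /x' FZ // GZ // -ractB ractA -rsM mulVf ?gt_eqF // rs1.
  by rewrite ract1.
apply: (le_trans (l2norm_ract_rs (ltW x_gt0) (FGl2 _ lx'))).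
by rewrite mulrC ler_wpM2r // ltW.
Qed.

Section Corner.
Variables (G : Ba A) (M1 M2 N2 : set (nat -> A)) (p : (nat -> A) -> nat -> A).
Variable c : R.
Hypotheses (cM1 : closed_submodule M1) (MN2 : direct_sum_decomp M2 N2).
Hypotheses (pP : is_proj M2 N2 p) (c0 : 0 <= c).
Hypothesis below : forall x, M1 x -> l2norm x <= c * l2norm (p (G x)).
Hypothesis onto : forall y, M2 y -> exists2 x, M1 x & p (G x) = y.

Let cM2 : closed_submodule M2. Proof. by case: MN2. Qed.
Let cN2 : closed_submodule N2. Proof. by case: MN2. Qed.
Let lM1 x : M1 x -> l2 x. Proof. exact: closed_submodule_l2. Qed.
Let lG x : l2 x -> l2 (G x). Proof. exact: Ba_l2. Qed.
Let pB x y : l2 x -> l2 y -> p (x - y) = p x - p y.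
Proof. by case: pP => lp _ _ _; exact: linear_onB (closed_submodule_setl2 A) lp. Qed.
Let N2P x : l2 x -> p x = 0 -> N2 x.
Proof. by case: pP => _ _ N2p _ lx px; have := N2p x lx; rewrite px subr0. Qed.
Let pN2 x : N2 x -> p x = 0. Proof. exact: (proj_eq0 cM2 pP). Qed.

Definition l2_preim := [set x | l2 x /\ N2 (G x)].

Lemma closed_submodule_l2_preim : closed_submodule l2_preim.
Proof.
have [GD GZ] := Ba_linear G.
split=> [x []//||x y [lx Nx] [ly Ny]|x a [lx Nx]|x lx hx].
- split; first exact: l2_0.
  rewrite (linear_on0 (closed_submodule_setl2 A) (Ba_linear G)).
  exact: closed_submodule0.
- by split; [exact: l2D|rewrite GD //; exact: closed_submoduleD].
- by split; [exact: l2_ract|rewrite GZ //; exact: closed_submodule_ract].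
split=> //; case: cN2 => _ _ _ _; apply; first exact: lG.
have [d d0 hd] := Ba_bound G; have d1 : 0 < d + 1 by rewrite ltr_wpDl.
move=> e e0; have [y [ly Ny] xy] := hx (e / (d + 1)) (divr_gt0 e0 d1).
exists (G y) => //; rewrite -BaB //; apply: (le_lt_trans (hd _ (l2B lx ly))).
apply: (@le_lt_trans _ _ ((d + 1) * l2norm (x - y))).
  by rewrite ler_wpM2r ?l2norm_ge0 // lerDl.
by rewrite mulrC -ltr_pdivlMr.
Qed.

(** [M1] is a complement of [G^-1 N2], the kernel of [p G], because [p G] is
    bijective on [M1]. *)
Lemma direct_sum_l2_preim : direct_sum_decomp M1 l2_preim.
Proof.
split=> //; first exact: closed_submodule_l2_preim.
  apply/seteqP; split=> [x [Mx [lx Nx]]|_ ->] /=; last first.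
    by split; [exact: closed_submodule0|exact: closed_submodule0 closed_submodule_l2_preim].
  apply: l2norm_eq0 => //; apply: (le_trans (below Mx)).
  by rewrite pN2 // l2norm0 mulr0.
move=> x lx; case: (pP) => _ M2p _ _.
have [m Mm pm] := onto (M2p _ (lG lx)); have lm := lM1 Mm.
exists m, (x - m); split=> //; last by rewrite addrC subrK.
split; first exact: l2B.
apply: N2P; first by apply/lG/l2B.
by rewrite BaB // pB ?pm ?subrr //; exact: lG.
Qed.

Lemma below_image :
  exists2 b : R, 0 <= b & forall x, M1 x -> l2norm x <= b * l2norm (G x).
Proof.
have [k k0 hk] := proj_bound MN2 pP; exists (c * k); first exact: mulr_ge0.
move=> x Mx; apply: (le_trans (below Mx)); rewrite -mulrA ler_wpM2l //.
exact/hk/lG/lM1.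
Qed.

(** [G] is bounded below on [M1], so preimages of a convergent sequence of values
    converge. *)
Lemma closed_submodule_image : closed_submodule (G @` M1).
Proof.
have [GD GZ] := Ba_linear G; have [b b0 hb] := below_image.
split=> [_ [x Mx <-]||_ _ [x Mx <-] [y My <-]|_ a [x Mx <-]|y ly hy].
- exact/lG/lM1.
- exists 0; first exact: closed_submodule0.
  exact: linear_on0 (closed_submodule_setl2 A) (Ba_linear G).
- by exists (x + y); [exact: closed_submoduleD|rewrite GD //; exact: lM1].
- by exists (ract x a); [exact: closed_submodule_ract|rewrite GZ //; exact: lM1].
pose h (k : nat) : R := (2 ^+ k)^-1.
have h0 k : 0 < h k by rewrite invr_gt0 exprn_gt0.
have hS k : h k.+1 = h k / 2 by rewrite /h exprSr invfM.
have /choice[X hX] : forall k, exists x, M1 x /\ l2norm (y - G x) < h k.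
  by move=> k; have [_ [x Mx <-] xy] := hy _ (h0 k); exists x.
have MX k : M1 (X k) := proj1 (hX k); have lX k := lM1 (MX k).
have GX k : l2norm (y - G (X k)) <= h k := ltW (proj2 (hX k)).
have [k|k|k|x lx hx] := @l2_complete _ _ X (fun k => b * (2 * h k)).
- exact: lX.
- by rewrite hS !mulrA.
- apply: (le_trans (hb _ (closed_submoduleB cM1 (MX _) (MX _)))).
  rewrite ler_wpM2l // BaB //.
  apply: (le_trans (l2norm_sub_le (lG (lX _)) ly (lG (lX _)))).
  have := GX k; have := GX k.+1; rewrite (l2normC y (G (X k.+1))) hS.
  have := h0 k; lra.
have hsmall e : 0 < e -> exists k, h k < e.
  move=> e0; have [|k|k hk] := halving_small _ _ e0 (d := h).
  - by move=> k; exact: ltW.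
  - by rewrite hS.
  - by exists k; exact: hk.
have Mx : M1 x.
  case: cM1 => _ _ _ _; apply => // e e0.
  have b1 : 0 < 4 * b + 1 by rewrite ltr_wpDl // mulr_ge0.
  have [k hk] := hsmall (e / (4 * b + 1)) (divr_gt0 e0 b1).
  exists (X k) => //; rewrite l2normC; apply: (le_lt_trans (hx k)).
  move: hk; rewrite ltr_pdivlMr //; have := h0 k; lra.
exists x => //; apply/eqP; rewrite -subr_eq0; apply/eqP.
apply: l2norm_eq0; first by apply: l2B => //; exact: lG.
have [d d0 hd] := Ba_bound G.
have K0 : 0 <= 4 * (d * b) + 1 by rewrite addr_ge0 // !mulr_ge0.
apply: (le_addgt0 K0) => e e0; have [k hk] := hsmall e e0.
apply: (le_trans (l2norm_sub_le (lG lx) (lG (lX k)) ly)).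
have := GX k; rewrite (l2normC y) -BaB // (l2normC (G (X k)) y) -(l2normC (G (X k))).
have := hd _ (l2B lx (lX k)); rewrite (l2normC x).
have : d * l2norm (X k - x) <= d * (2 * (b * (2 * h k))) by rewrite ler_wpM2l.
have : d * b * h k <= d * b * e by apply: ler_wpM2l; [exact: mulr_ge0|exact: ltW].
lra.
Qed.

Lemma direct_sum_image : direct_sum_decomp (G @` M1) N2.
Proof.
split=> //; first exact: closed_submodule_image.
  apply/seteqP; split=> [_ [[x Mx <-] Nx]|_ ->] /=; last first.
    by split; [exact: closed_submodule0 closed_submodule_image|exact: closed_submodule0].
  have -> : x = 0.
    apply: l2norm_eq0; first exact: lM1.
    by apply: (le_trans (below Mx)); rewrite pN2 // l2norm0 mulr0.
  exact: linear_on0 (closed_submodule_setl2 A) (Ba_linear G).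
move=> y ly; case: (pP) => _ M2p _ _.
have [m Mm pm] := onto (M2p _ ly); have lGm := lG (lM1 Mm).
exists (G m), (y - G m); split; [by exists m| |by rewrite addrC subrK].
by apply: N2P; [exact: l2B|rewrite pB // pm subrr].
Qed.

Lemma corner_decomp : MPhi_decomp G M1 l2_preim (G @` M1) N2.
Proof.
split; [exact: direct_sum_l2_preim|exact: direct_sum_image|by []| |].
  by move=> _ [x [_ Nx] <-].
have [b b0 hb] := below_image.
have [d d0 hd] := Ba_bound G.
split; last by exists b.
- apply: linear_on_sub (Ba_linear G); exact: lM1.
- split=> [x Mx|x y|y]; [by exists x| |by []].
  rewrite !inE => Mx My xy; apply/eqP; rewrite -subr_eq0; apply/eqP.
  have Mxy : M1 (x - y) by exact: closed_submoduleB.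
  apply: l2norm_eq0; first exact: lM1.
  apply: (le_trans (hb _ Mxy)).
  rewrite BaB ?xy ?subrr ?l2norm0 ?mulr0 //; exact: lM1.
- by exists d => x /lM1; exact: hd.
Qed.

End Corner.

(** The equation [p (G x) = y] in [M1] is the fixed point equation
    [x = F^-1 (y + p (F x - G x))], whose right-hand side is a contraction for
    [G] close to [F]. *)
Lemma MPhi_decomp_near F M1 N1 M2 N2 : MPhi_decomp F M1 N1 M2 N2 ->
  exists2 e : R, 0 < e & forall G, opdist F G < e ->
    exists N1' M2', MPhi_decomp G M1 N1' M2' N2.
Proof.
move=> [MN1 MN2 FM1 FN1 iF].
have [cM1 _ _ _] := MN1; have [cM2 cN2 _ _] := MN2.
have [p pP] := direct_sum_proj MN2; have [lp M2p _ _] := pP.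
have [k k0 hk] := proj_bound MN2 pP.
have [s sP] := hilbert_iso_inv iF.
have [b b0 hb] : exists2 b : R, 0 <= b & forall x, M1 x -> l2norm x <= b * l2norm (F x).
  have [_ _ _ [b hb]] := iF; exists `|b| => // x Mx.
  by apply: (le_trans (hb x Mx)); rewrite ler_wpM2r ?l2norm_ge0 ?ler_norm.
have bk0 : 0 <= b * k by exact: mulr_ge0.
(* b bounds the inverse of F on M1 and k bounds p: the contraction ratio is
   b k e <= 1/2. *)
pose e := (2 * (b * k + 1))^-1.
have e0 : 0 < e by rewrite invr_gt0 mulr_gt0 // ltr_wpDl.
have bke : b * (k * e) <= 2^-1.
  rewrite mulrA /e ler_pdivrMr; last by rewrite mulr_gt0 // ltr_wpDl.
  lra.
exists e => // G eG.
have lF x : l2 x -> l2 (F x) by exact: Ba_l2.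
have lG x : l2 x -> l2 (G x) by exact: Ba_l2.
have lM1 x : M1 x -> l2 x by exact: closed_submodule_l2.
have lM2 x : M2 x -> l2 x by exact: closed_submodule_l2.
have lD x : l2 x -> l2 (F x - G x) by move=> lx; apply: l2B; [exact: lF|exact: lG].
have M2F x : M1 x -> M2 (F x) by move=> Mx; apply: FM1; exists x.
have pB x y : l2 x -> l2 y -> p (x - y) = p x - p y.
  exact: linear_onB (closed_submodule_setl2 A) lp.
pose q x := p (F x - G x).
have qB x y : l2 x -> l2 y -> q x - q y = q (x - y).
  move=> lx ly; rewrite /q -pB; [|exact: lD|exact: lD].
  by rewrite !BaB // [in LHS]opprD addrACA -[in LHS]opprD.
have hq x : l2 x -> l2norm (q x) <= k * e * l2norm x.
  move=> lx; apply: (le_trans (hk _ (lD _ lx))); rewrite -mulrA ler_wpM2l //.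
  apply: (le_trans (opdist_bound _ _ lx)).
  by rewrite ler_wpM2r ?l2norm_ge0 // ltW.
have bq x : l2 x -> b * l2norm (q x) <= l2norm x / 2.
  move=> lx; apply: (@le_trans _ _ (b * (k * e * l2norm x))).
    by rewrite ler_wpM2l // hq.
  by rewrite mulrA [leRHS]mulrC ler_wpM2r ?l2norm_ge0.
have M2q x : l2 x -> M2 (q x) by move=> lx; exact/M2p/lD.
have pG x : M1 x -> p (G x) = F x - q x.
  move=> Mx; have lx := lM1 _ Mx; rewrite /q pB; [|exact: lF|exact: lG].
  by rewrite (proj_id cN2 pP (M2F _ Mx)) subKr.
have below x : M1 x -> l2norm x <= (2 * b) * l2norm (p (G x)).
  move=> Mx; have lx := lM1 _ Mx; have := hb x Mx.
  have FE : p (G x) + q x = F x by rewrite pG // subrK.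
  have := l2normD (lM2 _ (M2p _ (lG _ lx))) (lM2 _ (M2q _ lx)).
  rewrite FE => /(ler_wpM2l b0).
  have := bq x lx; lra.
have onto y : M2 y -> exists2 x, M1 x & p (G x) = y.
  move=> My; pose X n := iter n (fun x : nat -> A => s (y + q x)) 0.
  have MX n : M1 (X n).
    elim: n => [|n IH]; first exact: closed_submodule0.
    have [] // := sP (y + q (X n)).
    by apply: closed_submoduleD => //; exact/M2q/lM1.
  have lX n := lM1 _ (MX n).
  have FX n : F (X n.+1) = y + q (X n).
    have [] // := sP (y + q (X n)).
    by apply: closed_submoduleD => //; exact: M2q.
  pose d n := l2norm (X n.+1 - X n).
  have dhalf n : d n.+1 <= d n / 2.
    have M1B := closed_submoduleB cM1 (MX n.+2) (MX n.+1).
    apply: (le_trans (hb _ M1B)).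
    rewrite BaB // !FX opprD addrACA subrr add0r qB //.
    exact/bq/l2B.
  have [x lx hx] := l2_complete lX dhalf (fun n => lexx _).
  have dsmall t : 0 < t -> exists n, d n < t.
    move=> t0; have [|n hn] := halving_small (d := d) _ dhalf t0.
      by move=> n; exact: l2norm_ge0.
    by exists n; exact: hn.
  have Mx : M1 x.
    case: cM1 => _ _ _ _; apply => // t t0.
    have [n hn] := dsmall (t / 2) (divr_gt0 t0 (ltr0n _ 2)).
    exists (X n) => //; rewrite l2normC; apply: (le_lt_trans (hx n)); lra.
  exists x => //; rewrite pG //; apply/eqP; rewrite subr_eq -subr_eq0; apply/eqP.
  have [f f0 hf] := Ba_bound F.
  have lq z : l2 z -> l2 (q z) by move=> /M2q; exact: lM2.
  apply: l2norm_eq0; first by apply: l2B; [exact: lF|apply: l2D; [exact: lM2|exact: lq]].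
  have K0 : 0 <= f + 2 * (k * e) by rewrite addr_ge0 // !mulr_ge0 // ltW.
  apply: (le_addgt0 K0) => t t0; have [n hn] := dsmall t t0.
  have -> : F x - (y + q x) = F (x - X n.+1) + q (X n - x).
    by rewrite BaB // -qB // FX !opprD !addrA subrK.
  have l1 := lF _ (l2B lx (lX n.+1)); have l2' := lq _ (l2B (lX n) lx).
  apply: (le_trans (l2normD l1 l2')).
  have := hf _ (l2B lx (lX n.+1)); have := hq _ (l2B (lX n) lx).
  rewrite (l2normC x).
  have : f * l2norm (X n.+1 - x) <= f * t.
    rewrite ler_wpM2l //; apply: (le_trans (hx n.+1)).
    by have := dhalf n; lra.
  have : k * e * l2norm (X n - x) <= k * e * (2 * t).
    apply: ler_wpM2l; first by rewrite mulr_ge0 // ltW.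
    by apply: (le_trans (hx n)); lra.
  lra.
exists (l2_preim G N2), (G @` M1).
apply: (corner_decomp cM1 MN2 pP _ below onto).
by rewrite mulr_ge0.
Qed.

End Perturbation.

Theorem theorem4p1 (R : realType) (A : unitalCStarType R) :
  open (MPhi_plus A `\` MPhi A) /\ open (MPhi_minus A `\` MPhi A).
Proof.
split.
- move=> F [[M1 [N1 [M2 [N2 [DF gN1]]]]] nF].
  have [e e0 near] := MPhi_decomp_near DF; exists e => // G /near[N1' [M2' DG]].
  have [MN1 _ _ _ _] := DF; have [MN1' _ _ _ _] := DG.
  have gN1' := fg_complement MN1 MN1' gN1.
  split; first by exists M1, N1', M2', N2.
  move=> [K1 [L1 [K2 [L2 [D gL1 gL2]]]]]; apply: nF.
  exists M1, N1, M2, N2; split => //.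
  exact: (fg_cokernel_part D DG gL2 gN1').
- move=> F [[M1 [N1 [M2 [N2 [DF gN2]]]]] nF].
  have [e e0 near] := MPhi_decomp_near DF; exists e => // G /near[N1' [M2' DG]].
  have [MN1 _ _ _ _] := DF; have [MN1' _ _ _ _] := DG.
  split; first by exists M1, N1', M2', N2.
  move=> [K1 [L1 [K2 [L2 [D gL1 gL2]]]]]; apply: nF.
  exists M1, N1, M2, N2; split => //.
  apply: (fg_complement MN1' MN1).
  exact: (fg_kernel_part D DG gL1 gN2).
Qed.
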